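(* Let $N\ge1$. Let $D_k$ ($k\ge0$) be the normalized one-row Capelli elements and $c_{2r-1}$ ($r\ge1$) Sergeev's odd cyclic elements in $Z(\mathrm U(\mathfrak q_N))$. Put $\beta_0=1$ and $\beta_j=\sum_{k=1}^jS(j,k)D_k$ for $j\ge1$, where $S(j,k)$ are Stirling numbers of the second kind. Then for every $n\ge1$, $$\sum_{j=1}^{n-1}jS(n-1,j)D_j=\sum_{r=1}^{\lfloor n/2\rfloor}\ \sum_{m=2r}^{n}(-1)^m\binom{m-r-1}{r-1}\beta_{n-m}c_{2r-1}.$$ For $n=1$, both sides are zero.
   Context: Ground field $\mathbb C$. Queer Lie superalgebra: fix $N\ge1$, $I_N=\{-N,\dots,-1,1,\dots,N\}$, $\bar i=0$ if $i>0$ and $\bar i=1$ if $i<0$. Let $E_{ij}$ ($i,j\in I_N$) be the matrix units of $\mathfrak{gl}(N|N)$, of parity $\bar i+\bar j$ mod $2$. $\mathfrak q_N\subset\mathfrak{gl}(N|N)$ is the Lie sub-superalgebra spanned by $F_{ij}=E_{ij}+E_{-i,-j}$ (so $F_{-i,-j}=F_{ij}$). $\mathrm U(\mathfrak q_N)$ is its universal enveloping algebra and $Z_N=Z(\mathrm U(\mathfrak q_N))$ its center (in the superalgebra sense; all central elements are even). Harish-Chandra map: $\mathfrak h_{\bar0}=\bigoplus_{i=1}^N\mathbb C F_{ii}$, $\mathfrak h_{\bar 1}=\bigoplus_{i=1}^N\mathbb C F_{i,-i}$, $\mathfrak n_+$ (resp. $\mathfrak n_-$) is the span of $F_{ij},F_{i,-j}$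 with $1\le i<j\le N$ (resp. $1\le j<i\le N$). For $z\in Z_N$, $\mathrm{HC}(z)\in\mathbb C[\lambda_1,\dots,\lambda_N]$ is the polynomial with $z\equiv \mathrm{HC}(z)|_{\lambda_i=F_{ii}}$ modulo $\mathfrak n_-\mathrm U(\mathfrak q_N)+\mathrm U(\mathfrak q_N)\mathfrak n_+$ (no $\rho$-shift). It is known that $\mathrm{HC}$ is an algebra isomorphism of $Z_N$ onto $\Gamma_N$, the algebra of symmetric polynomials $f\in\mathbb C[\lambda_1,\dots,\lambda_N]$ such that $f(t,-t,\lambda_3,\dots,\lambda_N)$ is independent of $t$ (no condition if $N=1$). Cyclic elements: for $r\ge1$, $$c_r=\sum_{i_1,\dots,i_r\in I_N}(-1)^{\bar i_2+\cdots+\bar i_r}F_{i_1i_2}F_{i_2i_3}\cdots F_{i_ri_1}\in \mathrm U(\mathfrak q_N);$$ these are known to be central. Normalized one-row Capelli elements: $(u\downarrow r)=u(u-1)\cdots(u-r+1)$, $(u\downarrow0)=1$. Let $Q^-_{(0)}=1$ and for $r\ge1$ let $Q^-_{(r)}\in\Gamma_N$ be the one-row factorial Schur $Q$-polynomial $Q^-_{(r)}(\lambda)=2\sum_{i=1}^N(\lambda_i\downarrow r)\prod_{j\ne i}\frac{\lambda_i+\lambda_j}{\lambda_i-\lambda_j}$; equivalently $\sum_{r\ge0}Q^-_{(r)}(\lambda)/(u\downarrow r)=\prod_{i=1}^N\frac{u+1+\lambda_i}{u+1-\lambda_i}$ as series in $u^{-1}$. Then $D_0=1$ and $D_r=\frac1{r!}C_{(r)}$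 for $r\ge1$, where $C_{(r)}$ is Nazarov's Capelli element of the one-row strict partition $(r)$; $D_r$ is the unique element of $Z_N$ with $\mathrm{HC}(D_r)=Q^-_{(r)}$. Stirling numbers: $S(n,r)$ is the number of partitions of $\{1,\dots,n\}$ into $r$ nonempty blocks, with $S(0,0)=1$, $S(n,0)=0$ for $n>0$, $S(n,r)=0$ if $r<0$ or $r>n$. *)

(* Defs.v *)
From HB Require Import structures.
From mathcomp Require Import all_boot all_order all_algebra.
From mathcomp Require Import ring_quotient complex boolp reals.
From mathcomp Require Import monalg.
From mathcomp Require Import mpoly.

Set Implicit Arguments.
Unset Strict Implicit.
Unset Printing Implicit Defensive.

Import GRing.Theory.
Local Open Scope ring_scope.
Local Open Scope quotient_scope.

(* monalg also declares this notation, in type_scope. *)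
Local Notation "{ 'mpoly' T [ n ] }" := (mpoly n T) : type_scope.

Section IndexSet.
Variable N : nat.

(* I_N = {-N,..,-1,1,..,N} is encoded as 'I_(N + N): pos i stands for i+1 and
   neg i for -(i+1), where i : 'I_N counts from 0. *)
Definition pos (i : 'I_N) : 'I_(N + N) := lshift N i.
Definition neg (i : 'I_N) : 'I_(N + N) := rshift N i.

Definition bar (a : 'I_(N + N)) : bool := if split a is inr _ then true else false.

Definition opp_idx (a : 'I_(N + N)) : 'I_(N + N) :=
  match split a with inl i => neg i | inr i => pos i end.

End IndexSet.

Section Queer.
Variables (R : realType) (N : nat).
Local Notation C := R[i].
Local Notation gl := 'M[C]_(N + N).

Definition homogeneous (p : bool) (A : gl) : Prop :=
  forall i j, A i j != 0 -> bar i (+) bar j = p.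

(* The super-bracket [A, B], for A, B homogeneous of parities p, q. *)
Definition superbracket (p q : bool) (A B : gl) : gl :=
  A *m B - (-1) ^+ (p && q) *: (B *m A).

Definition Fmx (i j : 'I_(N + N)) : gl :=
  delta_mx i j + delta_mx (opp_idx i) (opp_idx j).

Definition queer : {vspace gl} := (\sum_i \sum_j <[Fmx i j]>)%VS.

Definition nplus : {vspace gl} :=
  (\sum_(i < N) \sum_(j < N | (i < j)%N)
     (<[Fmx (pos i) (pos j)]> + <[Fmx (pos i) (neg j)]>))%VS.

Definition nminus : {vspace gl} :=
  (\sum_(i < N) \sum_(j < N | (j < i)%N)
     (<[Fmx (pos i) (pos j)]> + <[Fmx (pos i) (neg j)]>))%VS.

Lemma Fmx_queer i j : Fmx i j \in queer.
Proof.
have /subvP sub : (<[Fmx i j]> <= queer)%VS.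
  by apply: (sumv_sup i) => //; apply: (sumv_sup j).
exact: sub (memv_line _).
Qed.

Local Notation qN := (subvs_of queer).

(* The free associative algebra on the set qN. Modulo the relations Urel_linear
   it is the tensor algebra of the vector space qN, and modulo all of Urel the
   universal enveloping algebra. *)
Definition freealg := {malg C[{fmonom qN}]}.
HB.instance Definition _ := GRing.Lalgebra.on freealg.

Fact freealg_scaleAr (a : C) (s t : freealg) : a *: (s * t) = s * (a *: t).
Proof.
have scaleC u : a *: u = u * malgC a :> freealg.
  rewrite malgM_def malgZ_def fgmulgU; apply/eq_bigr => k _.
  by rewrite mulm1 mulrC.
by rewrite !scaleC; exact: esym (mulrA _ _ _).
Qed.
HB.instance Definition _ := GRing.Lalgebra_isAlgebra.Build C freealg
  freealg_scaleAr.

Definition freegen (x : qN) : freealg := mkmalgU (fmu x) 1.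

(* In Urel_bracket such a z always exists, since queer is closed under the
   super-bracket. *)
Inductive Urel : freealg -> Prop :=
| Urel_linear (a : C) (x y : qN) :
    Urel (freegen (a *: x + y) - (a *: freegen x + freegen y))
| Urel_bracket (p q : bool) (x y z : qN) :
    homogeneous p (vsval x) -> homogeneous q (vsval y) ->
    vsval z = superbracket p q (vsval x) (vsval y) ->
    Urel (freegen x * freegen y - (-1) ^+ (p && q) *: (freegen y * freegen x)
          - freegen z).

(* The two-sided ideal generated by Urel. *)
Inductive Uideal_gen : freealg -> Prop :=
| Uideal_rel t : Urel t -> Uideal_gen t
| Uideal_0 : Uideal_gen 0
| Uideal_D s t : Uideal_gen s -> Uideal_gen t -> Uideal_gen (s + t)
| Uideal_Ml a t : Uideal_gen t -> Uideal_gen (a * t)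
| Uideal_Mr a t : Uideal_gen t -> Uideal_gen (t * a).

Definition Uideal : pred freealg := fun t => `[< Uideal_gen t >].

Lemma UidealP t : reflect (Uideal_gen t) (t \in Uideal).
Proof. exact: asboolP. Qed.

Fact Uideal_zmod_closed : zmod_closed Uideal.
Proof.
split=> [|s t /UidealP Is /UidealP It]; apply/UidealP; first exact: Uideal_0.
by apply: Uideal_D => //; rewrite -mulN1r; apply: Uideal_Ml.
Qed.
HB.instance Definition _ := GRing.isZmodClosed.Build freealg Uideal
  Uideal_zmod_closed.

Lemma Uideal_add s t : s \in Uideal -> t \in Uideal -> s + t \in Uideal.
Proof. by move=> /UidealP Is /UidealP It; apply/UidealP; apply: Uideal_D. Qed.

Lemma Uideal_mull a t : t \in Uideal -> a * t \in Uideal.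
Proof. by move=> /UidealP It; apply/UidealP; apply: Uideal_Ml. Qed.

Lemma Uideal_mulr a t : t \in Uideal -> t * a \in Uideal.
Proof. by move=> /UidealP It; apply/UidealP; apply: Uideal_Mr. Qed.

Fact Uideal_proper : 1 \notin Uideal.
Proof.
apply/negP => /UidealP.
pose aug : freealg -> C := monalg.mcoeff (mone : {fmonom qN}).
have: aug 1 = 1 by exact: rmorph1.
have: forall x, aug (freegen x) = 0.
  by move=> x; rewrite /aug /freegen monalg.mcoeffU fm1_eq1.
have: aug 0 = 0 by exact: raddf0.
have: forall s t, aug (s * t) = aug s * aug t by exact: rmorphM.
have: forall a t, aug (a *: t) = a * aug t.
  by move=> a t; exact: monalg.mcoeffZ.
have: forall s t, aug (s + t) = aug s + aug t by exact: raddfD.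
have: forall s t, aug (s - t) = aug s - aug t by exact: raddfB.
move: aug => aug augB augD augZ augM aug0 aug_gen aug1 I1.
suff aug_ideal t : Uideal_gen t -> aug t = 0.
  by have /eqP := aug_ideal _ I1; rewrite aug1 oner_eq0.
elim=> {t} [t [a x y | p q x y z _ _ _] | | s t _ IHs _ IHt | a t _ IH | a t _ IH].
- apply: etrans (augB _ _) _; rewrite aug_gen; apply/eqP.
  rewrite subr_eq0 eq_sym; apply/eqP; apply: etrans (augD _ _) _.
  by rewrite aug_gen addr0; apply: etrans (augZ _ _) _; rewrite aug_gen mulr0.
- have augM0 (u v : qN) : aug (freegen u * freegen v) = 0.
    by apply: etrans (augM _ _) _; rewrite aug_gen mul0r.
  apply: etrans (augB _ _) _; rewrite aug_gen subr0.
  apply: etrans (augB _ _) _; rewrite augM0 sub0r; apply/eqP; rewrite oppr_eq0.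
  by apply/eqP; apply: etrans (augZ _ _) _; rewrite augM0 mulr0.
- by [].
- by rewrite augD IHs IHt addr0.
- by rewrite augM IH mulr0.
- by rewrite augM IH mul0r.
Qed.

Definition Uq := {ideal_quot (GRing.ZmodClosed.clone freealg Uideal _)}.
HB.instance Definition _ := GRing.Zmodule.on Uq.
HB.instance Definition _ := Quotient.on Uq.

Definition piU : freealg -> Uq := \pi_Uq.

Lemma piU_D : {morph piU : s t / s + t}.
Proof. by move=> s t; rewrite /piU !piE. Qed.

Lemma piU_eq s t : (piU s == piU t) = (s - t \in Uideal).
Proof. by rewrite /piU Quotient.idealrBE. Qed.

Lemma piU_repr (u : Uq) : piU (repr u) = u.
Proof. exact: reprK. Qed.

Definition Uone : Uq := locked (\pi_Uq 1).
Definition Umul : Uq -> Uq -> Uq := locked (fun u v => \pi_Uq (repr u * repr v)).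
Definition Uscale : C -> Uq -> Uq := locked (fun a u => \pi_Uq (a *: repr u)).

Lemma piU_1 : piU 1 = Uone. Proof. by rewrite /Uone -lock. Qed.

Lemma piU_M s t : piU (s * t) = Umul (piU s) (piU t).
Proof.
rewrite /Umul -lock; apply/eqP; rewrite piU_eq.
set s' := repr (piU s); set t' := repr (piU t).
have -> : s * t - s' * t' = s * (t - t') + (s - s') * t'.
  by rewrite [s * (t - t')]mulrBr [(s - s') * t']mulrBl addrA [_ + s * t']subrK.
apply: Uideal_add; [apply: Uideal_mull | apply: Uideal_mulr];
  by rewrite -piU_eq piU_repr.
Qed.

Lemma piU_Z a t : piU (a *: t) = Uscale a (piU t).
Proof.
rewrite /Uscale -lock; apply/eqP; rewrite piU_eq -scalerBr -mulr_algl; apply: Uideal_mull.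
by rewrite -piU_eq piU_repr.
Qed.

Fact UmulA : associative Umul.
Proof.
move=> u v w; rewrite -(piU_repr u) -(piU_repr v) -(piU_repr w).
by rewrite -!piU_M mulrA.
Qed.

Fact Umul1u : left_id Uone Umul.
Proof. by move=> u; rewrite -(piU_repr u) -piU_1 -piU_M mul1r. Qed.

Fact Umulu1 : right_id Uone Umul.
Proof. by move=> u; rewrite -(piU_repr u) -piU_1 -piU_M mulr1. Qed.

Fact UmulDl : left_distributive Umul +%R.
Proof.
move=> u v w; rewrite -(piU_repr u) -(piU_repr v) -(piU_repr w).
by rewrite -piU_D -!piU_M mulrDl piU_D.
Qed.

Fact UmulDr : right_distributive Umul +%R.
Proof.
move=> u v w; rewrite -(piU_repr u) -(piU_repr v) -(piU_repr w).
by rewrite -piU_D -!piU_M mulrDr piU_D.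
Qed.

Fact Uone_neq0 : Uone != 0.
Proof.
have piU0 : piU 0 = 0 by rewrite /piU piE.
by rewrite -piU_1 -piU0 piU_eq subr0 Uideal_proper.
Qed.

HB.instance Definition _ := GRing.Zmodule_isNzRing.Build Uq
  UmulA Umul1u Umulu1 UmulDl UmulDr Uone_neq0.

Fact UscaleA a b u : Uscale a (Uscale b u) = Uscale (a * b) u.
Proof. by rewrite -(piU_repr u) -!piU_Z scalerA. Qed.

Fact Uscale1 : left_id 1 Uscale.
Proof. by move=> u; rewrite -(piU_repr u) -piU_Z scale1r. Qed.

Fact UscaleDr : right_distributive Uscale +%R.
Proof.
move=> a u v; rewrite -(piU_repr u) -(piU_repr v).
by rewrite -piU_D -!piU_Z scalerDr piU_D.
Qed.

Fact UscaleDl u : {morph Uscale^~ u : a b / a + b}.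
Proof. by move=> a b; rewrite -(piU_repr u) -!piU_Z scalerDl piU_D. Qed.

HB.instance Definition _ := GRing.Zmodule_isLmodule.Build C Uq
  UscaleA Uscale1 UscaleDr UscaleDl.

Fact UscaleAl (a : C) (u v : Uq) : a *: (u * v) = (a *: u) * v.
Proof.
rewrite -(piU_repr u) -(piU_repr v).
change (Uscale a (Umul (piU (repr u)) (piU (repr v)))
        = Umul (Uscale a (piU (repr u))) (piU (repr v))).
by rewrite -piU_M -!piU_Z -piU_M scalerAl.
Qed.

HB.instance Definition _ := GRing.Lmodule_isLalgebra.Build C Uq UscaleAl.

Fact UscaleAr (a : C) (u v : Uq) : a *: (u * v) = u * (a *: v).
Proof.
rewrite -(piU_repr u) -(piU_repr v).
change (Uscale a (Umul (piU (repr u)) (piU (repr v)))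
        = Umul (piU (repr u)) (Uscale a (piU (repr v)))).
by rewrite -piU_M -!piU_Z -piU_M freealg_scaleAr.
Qed.

HB.instance Definition _ := GRing.Lalgebra_isAlgebra.Build C Uq UscaleAr.

Definition Uiota (x : qN) : Uq := piU (freegen x).

Definition Fgen (i j : 'I_(N + N)) : Uq := Uiota (Subvs (Fmx_queer i j)).

(* The Z/2-grading of the enveloping algebra. *)
Inductive Uhomogeneous : bool -> Uq -> Prop :=
| Uhomogeneous_gen p (x : qN) :
    homogeneous p (vsval x) -> Uhomogeneous p (Uiota x)
| Uhomogeneous_1 : Uhomogeneous false 1
| Uhomogeneous_M p q u v :
    Uhomogeneous p u -> Uhomogeneous q v -> Uhomogeneous (p (+) q) (u * v)
| Uhomogeneous_0 p : Uhomogeneous p 0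
| Uhomogeneous_D p u v :
    Uhomogeneous p u -> Uhomogeneous p v -> Uhomogeneous p (u + v)
| Uhomogeneous_Z p a u : Uhomogeneous p u -> Uhomogeneous p (a *: u).

(* The centre in the superalgebra sense: z0 and z1 are the even and odd
   components of z. *)
Definition in_center (z : Uq) : Prop :=
  exists z0 z1 : Uq,
    [/\ z = z0 + z1, Uhomogeneous false z0, Uhomogeneous true z1
      & forall p u, Uhomogeneous p u ->
          z0 * u = u * z0 /\ z1 * u = (-1) ^+ p *: (u * z1)].

(* nminus * U + U * nplus *)
Inductive nminusU_Unplus : Uq -> Prop :=
| nUUn_0 : nminusU_Unplus 0
| nUUn_D u v : nminusU_Unplus u -> nminusU_Unplus v -> nminusU_Unplus (u + v)
| nUUn_l (x : qN) u : vsval x \in nminus -> nminusU_Unplus (Uiota x * u)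
| nUUn_r u (x : qN) : vsval x \in nplus -> nminusU_Unplus (u * Uiota x).

(* The polynomial p evaluated at lambda_i = F_ii. *)
Definition eval_cartan (p : {mpoly C[N]}) : Uq :=
  mmap (in_alg Uq) (fun i : 'I_N => Fgen (pos i) (pos i)) p.

(* HC z p: the Harish-Chandra image of z is p. *)
Definition HC (z : Uq) (p : {mpoly C[N]}) : Prop :=
  in_center z /\ nminusU_Unplus (z - eval_cartan p).

Definition falling (A : pzRingType) (x : A) (r : nat) : A :=
  \prod_(k < r) (x - k%:R).

(* The one-row factorial Schur Q-polynomial, characterized by its expression
   as a rational function. *)
Definition is_rowQ (r : nat) (q : {mpoly C[N]}) : Prop :=
  if r is 0 then q = 1 else
  tofrac q = 2 * \sum_(i < N) tofrac (falling ('X_i : {mpoly C[N]}) r)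
    * \prod_(j < N | j != i) (tofrac ('X_i + 'X_j) / tofrac ('X_i - 'X_j)).

Definition is_capelli (r : nat) (z : Uq) : Prop :=
  if r is 0 then z = 1 else exists2 q, is_rowQ r q & HC z q.

(* For r >= 1; the indices are i_(k+1) = i k for k < r, taken cyclically. *)
Definition cyclic_elt (r : nat) : Uq :=
  \sum_(i : {ffun 'I_r -> 'I_(N + N)})
    (-1) ^+ (\sum_(k < r | (0 < k)%N) bar (i k))%N
      *: \prod_(k < r) Fgen (i k) (i (ordS k)).

End Queer.

Definition stirling2 (n r : nat) : nat :=
  #|[set P : {set {set 'I_n}} | partition P [set: 'I_n] & #|P| == r]|.

Definition beta (A : nzRingType) (D : nat -> A) (j : nat) : A :=
  if j is 0 then 1 else \sum_(1 <= k < j.+1) D k *+ stirling2 j k.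

(* Main.v *)
(* The Harish-Chandra map is multiplicative and injective on the centre, so the
   identity may be checked on Harish-Chandra images.

   Images. Modulo n_- U + U n_+ the diagonal entries of the powers of the matrix
   of generators satisfy a triangular recursion, whence with T = w(w+1)
     sum_r HC(c_(2r-1)) T^-r = 1 - prod_i (T - x_i(x_i+1)) / (T - x_i(x_i-1)).
   As x^n = sum_k S(n,k) (x down k), partial fractions show that the images of the
   beta_j are the coefficients of B(w) = prod_i (w + x_i) / (w - x_i) in 1/w, and
   the left-hand sides are those of B(w) - B(w+1). Since
     T - x(x+1) = (w - x)(w + 1 + x)  and  T - x(x-1) = (w + x)(w + 1 - x),
   the claim is B(w) - B(w+1) = B(w) (1 - B(w+1)/B(w)).

   Injectivity. Let z be central with z in n_- U + U n_+. The tensor powers of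
   V + 1 are unitary with F_ij adjoint to F_ji, so z v is both singular and
   orthogonal to singular vectors when v is singular; hence z v = 0. The image of
   the adjoint of z is stable under n_+, which is nilpotent, and is orthogonal to
   singular vectors; hence it is 0. So z acts by 0 on all these tensor powers, and
   these are jointly faithful: the d-th one recovers the degree d symbol of an
   element of filtration degree d. *)

Require Import Defs.
From HB Require Import structures.
From mathcomp Require Import all_boot all_order all_algebra.
From mathcomp Require Import ring_quotient complex boolp reals.
From mathcomp Require Import monalg.
From mathcomp Require Import mpoly.
From mathcomp Require Import zify ring qpoly.

Set Implicit Arguments.
Unset Strict Implicit.
Unset Printing Implicit Defensive.

Import Order.TTheory GRing.Theory Num.Theory.
Local Open Scope ring_scope.
Local Notation "{ 'mpoly' T [ n ] }" := (mpoly n T) : type_scope.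

(** Faithfulness is obtained without the PBW theorem: on the d-th tensor power a linear map recovers
    d! times the top symbol of an operator, and dividing by d! lowers the filtration degree.

    The tensor powers are never formed as spaces. Each is an operator algebra A with an adjoint and
    a parity operator; the next one consists of matrices over A, and A acting on itself by left
    multiplication supplies the vectors, with star(c) a as inner product.

    The definition of the centre admits an odd component, which the Harish-Chandra projection does
    not see separately; the parity operator splits it off.

    The polynomial identity is checked in the fraction field, where the variables are distinct and
    nonzero, as partial fractions require. For a given n only one coefficient is compared, so 1/w is
    modelled by a nilpotent t with t^(n+1) = 0. *)

Lemma sum_delta (V : zmodType) (I : finType) (f : I -> V) i :
  \sum_m f m *+ (i == m) = f i.
Proof.
rewrite (bigD1 i) //= eqxx mulr1n big1 ?addr0 // => j.
by rewrite eq_sym => /negbTE->; rewrite mulr0n.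
Qed.

(** * Signed indices and their parities *)

Section Idx.
Variable N : nat.
Implicit Types i j k : 'I_(N + N).

Lemma opp_pos (i : 'I_N) : opp_idx (pos i) = neg i.
Proof. by rewrite /opp_idx (unsplitK (inl i)). Qed.

Lemma opp_neg (i : 'I_N) : opp_idx (neg i) = pos i.
Proof. by rewrite /opp_idx (unsplitK (inr i)). Qed.

Lemma bar_pos (i : 'I_N) : bar (pos i) = false.
Proof. by rewrite /bar (unsplitK (inl i)). Qed.

Lemma bar_neg (i : 'I_N) : bar (neg i) = true.
Proof. by rewrite /bar (unsplitK (inr i)). Qed.

Lemma pos_neg_cases i : exists k : 'I_N, i = pos k \/ i = neg k.
Proof. by case: (split_ordP i) => k ->; exists k; [left | right]. Qed.

Lemma opp_idxK : involutive (@opp_idx N).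
Proof.
by move=> i; have [k [->|->]] := pos_neg_cases i; rewrite ?(opp_pos, opp_neg).
Qed.

Lemma bar_opp i : bar (opp_idx i) = ~~ bar i.
Proof.
have [k [->|->]] := pos_neg_cases i;
by rewrite ?opp_pos ?opp_neg ?bar_pos ?bar_neg.
Qed.

Lemma opp_idx_eq i j : (opp_idx i == j) = (i == opp_idx j).
Proof. by rewrite -{2}(opp_idxK i) (inj_eq (inv_inj opp_idxK)). Qed.

Lemma sum_posneg (V : zmodType) (f : 'I_(N + N) -> V) :
  \sum_i f i = \sum_i (f (pos i) + f (neg i)).
Proof. by rewrite big_split_ord big_split. Qed.

End Idx.

Definition par (N : nat) (i j : 'I_(N + N)) := bar i (+) bar j.

Lemma par_diag (N : nat) (i : 'I_(N + N)) : par i i = false.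
Proof. exact: addbb. Qed.

(** * Super-commutation relations and cyclic elements *)

Section SuperBracket.
Variables (K : comNzRingType) (U : algType K).

(** The parities are arguments because [U] carries no grading here. *)
Definition sbr (p q : bool) (a b : U) : U := a * b - (-1) ^+ (p && q) *: (b * a).

(** Super Leibniz rule: bracketing with a is a derivation up to the sign of passing b. *)
Lemma sbrM p q r a b c :
  sbr p (q (+) r) a (b * c) =
  sbr p q a b * c + (-1) ^+ (p && q) *: (b * sbr p r a c).
Proof.
rewrite /sbr mulrBl mulrBr scalerBr -!scalerAl -!scalerAr scalerA.
rewrite -signr_addb -andb_addr !mulrA addrA; congr (_ - _).
by rewrite subrK.
Qed.

Lemma sbrZ p q x a b : sbr p q a (x *: b) = x *: sbr p q a b.
Proof.
by rewrite /sbr -scalerAr -scalerAl scalerBr !scalerA mulrC.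
Qed.

Lemma sbr_sum p q (I : finType) a (f : I -> U) :
  sbr p q a (\sum_i f i) = \sum_i sbr p q a (f i).
Proof.
rewrite /sbr mulr_sumr mulr_suml scaler_sumr -sumrB.
by apply: eq_bigr.
Qed.

Lemma sbrE p q a b : a * b = (-1) ^+ (p && q) *: (b * a) + sbr p q a b.
Proof. by rewrite /sbr addrC subrK. Qed.

End SuperBracket.

Section Cyclic.
Variables (K : comNzRingType) (U : algType K) (N : nat).
Variable F : 'I_(N + N) -> 'I_(N + N) -> U.

(** This is the power n + 1 of the matrix of generators, each inner index carrying the sign that
    occurs in the cyclic elements. *)
Fixpoint Xpow (n : nat) (k l : 'I_(N + N)) : U :=
  if n is n'.+1 then \sum_m (-1) ^+ bar m *: (Xpow n' k m * F m l) else F k l.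

(* The shape of the super-bracket of F_ij with an I_N x I_N tensor. *)
Definition tensor_action (Y : 'I_(N + N) -> 'I_(N + N) -> U) i j k l : U :=
  Y i l *+ (j == k) + Y (opp_idx i) l *+ (opp_idx j == k)
  - (-1) ^+ (par i j && par k l)
      *: (Y k j *+ (i == l) + Y k (opp_idx j) *+ (opp_idx i == l)).

Hypothesis F_opp : forall i j, F (opp_idx i) (opp_idx j) = F i j.
Hypothesis F_sbr : forall i j k l,
  sbr (par i j) (par k l) (F i j) (F k l) = tensor_action F i j k l.

(** Negating each of the n inner indices flips one sign. *)
Lemma Xpow_opp n k l :
  Xpow n (opp_idx k) (opp_idx l) = (-1) ^+ n *: Xpow n k l.
Proof.
elim: n k l => [|n IH] k l /=; first by rewrite scale1r.
rewrite (reindex_inj (inv_inj (@opp_idxK N))) scaler_sumr.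
apply: eq_bigr => m _; rewrite IH F_opp bar_opp -scalerAl !scalerA.
by congr (_ *: _); rewrite exprS; case: bar;
  rewrite ?expr0 ?expr1 ?mulN1r ?mulrN1 ?mulNr ?mul1r ?mulr1 ?opprK.
Qed.

(** Powers of the matrix transform under the bracket like the matrix itself. By the Leibniz rule the
    inner index m yields four extra terms, supported at m = i, -i, j, -j; they cancel in pairs since
    the signs agree ([s1] and [s2]). *)
Lemma Xpow_sbr n i j k l :
  sbr (par i j) (par k l) (F i j) (Xpow n k l) = tensor_action (Xpow n) i j k l.
Proof.
elim: n k l => [|n IH] k l; first exact: F_sbr.
rewrite /= sbr_sum.
set X := Xpow n in IH *.
have step m : sbr (par i j) (par k l) (F i j) ((-1) ^+ bar m *: (X k m * F m l)) =
   ((-1) ^+ bar m *: (X i m * F m l)) *+ (j == k)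
   + ((-1) ^+ bar m *: (X (opp_idx i) m * F m l)) *+ (opp_idx j == k)
   - ((-1) ^+ (bar m (+) (par i j && par k m)) *: (X k j * F m l)) *+ (i == m)
   - ((-1) ^+ (bar m (+) (par i j && par k m)) *: (X k (opp_idx j) * F m l))
       *+ (opp_idx i == m)
   + ((-1) ^+ (bar m (+) (par i j && par k m)) *: (X k m * F i l)) *+ (j == m)
   + ((-1) ^+ (bar m (+) (par i j && par k m)) *: (X k m * F (opp_idx i) l))
       *+ (opp_idx j == m)
   - ((-1) ^+ (par i j && par k l) *: ((-1) ^+ bar m *: (X k m * F m j)))
       *+ (i == l)
   - ((-1) ^+ (par i j && par k l) *:
        ((-1) ^+ bar m *: (X k m * F m (opp_idx j)))) *+ (opp_idx i == l).
  have -> : par k l = par k m (+) par m l.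
    by rewrite /par addbA -(addbA (bar k)) addbb addbF.
  rewrite sbrZ sbrM IH F_sbr /tensor_action.
  rewrite !mulrBl !mulrDl !mulrBr !mulrDr -!scalerAl -!scalerAr !mulrDl !mulrDr.
  rewrite !(mulrnAl, mulrnAr) !scalerBr !scalerDr !scalerMnr !scalerA.
  rewrite andb_addr !signr_addb !scalerN !scalerDr !scalerA.
  by rewrite [_ * ((-1) ^+ (par i j && par k m) * _)]mulrC !opprD !addrA.
rewrite (eq_bigr _ (fun m _ => step m)) !(big_split, sumrN) /=.
rewrite !sumrMnl !sum_delta -!scaler_sumr.
have s1 : bar i (+) (par i j && par k i) = bar j (+) (par i j && par k j).
  by rewrite /par; case: (bar i); case: (bar j); case: (bar k).
have s2 : bar (opp_idx i) (+) (par i j && par k (opp_idx i)) =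
   bar (opp_idx j) (+) (par i j && par k (opp_idx j)).
  by rewrite !bar_opp /par !bar_opp; case: (bar i); case: (bar j); case: (bar k).
rewrite s1 s2 /tensor_action /= scalerDr !scalerMnr opprD !addrA.
set a := _ *+ _; set b := _ *+ _; set c := _ *: _; set d := _ *: _.
set e := _ *+ _; set f := _ *+ _.
by rewrite [_ - d + c]addrAC !subrK.
Qed.

(** Diagonal entries are even, so no sign appears, and both halves of the tensor action sum to
    X_{ij} + X_{-i,-j}. *)
Lemma Xpow_trace_comm n i j :
  F i j * (\sum_k Xpow n k k) = (\sum_k Xpow n k k) * F i j.
Proof.
apply/eqP; rewrite -subr_eq0.
have -> : F i j * (\sum_k Xpow n k k) - (\sum_k Xpow n k k) * F i j =
  sbr (par i j) false (F i j) (\sum_k Xpow n k k).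
  by rewrite /sbr andbF scale1r.
rewrite sbr_sum; apply/eqP.
under eq_bigr => k _ do rewrite -(par_diag k) Xpow_sbr /tensor_action par_diag
  andbF scale1r opprD addrA.
rewrite !(big_split, sumrN) /= !sum_delta.
by rewrite addrAC addrK subrr.
Qed.

End Cyclic.

Section FfunRcons.
Variables (T : finType) (n : nat).

Definition ffun_rcons (p : {ffun 'I_n -> T} * T) : {ffun 'I_n.+1 -> T} :=
  [ffun k => if unlift ord_max k is Some j then p.1 j else p.2].

Lemma ffun_rcons_widen p (k : 'I_n) : ffun_rcons p (widen_ord (leqnSn n) k) = p.1 k.
Proof.
have -> : widen_ord (leqnSn n) k = lift ord_max k.
  by apply/val_inj; rewrite /= /bump leqNgt ltn_ord.
by rewrite ffunE liftK.
Qed.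

Lemma ffun_rcons_max p : ffun_rcons p ord_max = p.2.
Proof. by rewrite ffunE unlift_none. Qed.

Lemma ffun_rcons_bij : bijective ffun_rcons.
Proof.
exists (fun f : {ffun 'I_n.+1 -> T} =>
          ([ffun k => f (widen_ord (leqnSn n) k)], f ord_max)).
  move=> [f x]; congr (_, _); last by rewrite ffun_rcons_max.
  by apply/ffunP => k; rewrite ffunE ffun_rcons_widen.
move=> f; apply/ffunP => k.
have [ltkn|] := ltnP k n.
  have -> : k = widen_ord (leqnSn n) (Ordinal ltkn) by apply/val_inj.
  by rewrite ffun_rcons_widen ffunE.
move=> lenk; have -> : k = ord_max.
  by apply/val_inj/eqP; rewrite /= eqn_leq lenk -ltnS ltn_ord.
by rewrite ffun_rcons_max.
Qed.

End FfunRcons.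

Section CyclicSum.
Variables (K : comNzRingType) (U : algType K) (N : nat).
Variable F : 'I_(N + N) -> 'I_(N + N) -> U.

(** Paths end at a free index l rather than at their start, so that induction on the length applies;
    l = i_0 closes the cycle. *)
Definition next_index n (i : {ffun 'I_n.+1 -> 'I_(N + N)}) l (k : 'I_n.+1) :=
  if (k < n)%N then i (inord k.+1) else l.

Lemma Xpow_sum n a l :
  Xpow F n a l = \sum_(i : {ffun 'I_n.+1 -> 'I_(N + N)} | i ord0 == a)
    (-1) ^+ (\sum_(k < n.+1 | (0 < k)%N) bar (i k))%N
      *: \prod_(k < n.+1) F (i k) (next_index i l k).
Proof.
elim: n l => [|n IH] l.
  rewrite /= (big_pred1 [ffun=> a]) => [|i].
    by rewrite big_mkcond !big_ord1 /= !ffunE expr0 scale1r.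
  apply/eqP/eqP => [<-|->]; last by rewrite ffunE.
  by apply/ffunP => k; rewrite ffunE ord1.
rewrite [LHS]/= (reindex _ (onW_bij _ (@ffun_rcons_bij _ _))) /=.
transitivity (\sum_(m : 'I_(N + N))
   \sum_(i : {ffun 'I_n.+1 -> 'I_(N + N)} | i ord0 == a)
    (-1) ^+ (\sum_(k < n.+1 | (0 < k)%N) bar (i k) + bar m)%N
      *: (\prod_(k < n.+1) F (i k) (next_index i m k) * F m l)).
  apply: eq_bigr => m _; rewrite IH mulr_suml scaler_sumr.
  by apply: eq_bigr => i _; rewrite -scalerAl scalerA addnC exprD.
rewrite exchange_big pair_big /=.
have rcons0 p : @ffun_rcons 'I_(N + N) n.+1 p ord0 = p.1 ord0.
  by rewrite -(ffun_rcons_widen p); congr (ffun_rcons p _); apply/val_inj.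
apply: eq_big => [p|p _]; first by rewrite rcons0 andbT.
rewrite big_mkcond [in RHS]big_mkcond /= !(@big_ord_recr _ _ _ n.+1) /= !ffun_rcons_max.
congr ((-1) ^+ (_ + _) *: (_ * _)).
- by apply: eq_bigr => k _; rewrite ffun_rcons_widen.
- apply: eq_bigr => k _; rewrite ffun_rcons_widen; congr (F _ _).
  rewrite /next_index /= ltn_ord; case: ltnP => kn.
    rewrite -ffun_rcons_widen; congr (ffun_rcons p _); apply/val_inj.
    by rewrite /= !inordK // ltnS // ltnW.
  rewrite -(ffun_rcons_max p); congr (ffun_rcons p _); apply/val_inj.
  have kE : k = n :> nat by apply/eqP; rewrite eqn_leq kn andbT -ltnS ltn_ord.
  by rewrite /= kE inordK.
- by congr (F _ _); rewrite /next_index ltnn.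
Qed.

Lemma Xpow_trace n :
  \sum_k Xpow F n k k = \sum_(i : {ffun 'I_n.+1 -> 'I_(N + N)})
    (-1) ^+ (\sum_(k < n.+1 | (0 < k)%N) bar (i k))%N
      *: \prod_(k < n.+1) F (i k) (i (ordS k)).
Proof.
rewrite [RHS](partition_big (fun i : {ffun _} => i ord0) predT) //=.
apply: eq_bigr => a _; rewrite Xpow_sum; apply: eq_bigr => i /eqP <-.
congr (_ *: _); apply: eq_bigr => k _; congr (F _ _).
rewrite /next_index; case: ltnP => kn; congr (i _); apply/val_inj.
  by rewrite /= inordK // modn_small.
by rewrite /= (_ : k = n :> nat) ?modnn //; apply/eqP; rewrite eqn_leq kn -ltnS ltn_ord.
Qed.

End CyclicSum.

(** * The enveloping algebra and its length filtration *)

Section Words.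
Variables (K : comNzRingType) (U : algType K) (N : nat).
Variable F : 'I_(N + N) -> 'I_(N + N) -> U.
Hypothesis F_sbr : forall i j k l,
  sbr (par i j) (par k l) (F i j) (F k l) = tensor_action F i j k l.
Implicit Types i j k l : 'I_(N + N).

Definition Fword (w : seq ('I_(N + N) * 'I_(N + N))) : U :=
  \prod_(p <- w) F p.1 p.2.

Definition wpar (w : seq ('I_(N + N) * 'I_(N + N))) : bool :=
  \big[addb/false]_(p <- w) par p.1 p.2.

(** The bound on the length is strict, so [Ufilt 0] contains only 0. *)
Inductive Ufilt (d : nat) : U -> Prop :=
| Ufilt_word w : (size w < d)%N -> Ufilt d (Fword w)
| Ufilt_0 : Ufilt d 0
| Ufilt_D u v : Ufilt d u -> Ufilt d v -> Ufilt d (u + v)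
| Ufilt_Z a u : Ufilt d u -> Ufilt d (a *: u).

Lemma Ufilt_sum d (I : finType) (f : I -> U) :
  (forall x, Ufilt d (f x)) -> Ufilt d (\sum_x f x).
Proof. by move=> fP; apply: big_rec => [|i x _]; [exact: Ufilt_0 | exact: Ufilt_D]. Qed.

Lemma Ufilt_le d e u : (d <= e)%N -> Ufilt d u -> Ufilt e u.
Proof.
move=> de; elim=> {u} [w wd||u v _ IHu _ IHv|a u _ IH].
- by apply: Ufilt_word; apply: leq_trans wd de.
- exact: Ufilt_0.
- exact: Ufilt_D.
- exact: Ufilt_Z.
Qed.

Lemma Fword_cat w1 w2 : Fword (w1 ++ w2) = Fword w1 * Fword w2.
Proof. by rewrite /Fword big_cat. Qed.

Lemma Ufilt_wordl d w u : Ufilt d u -> Ufilt (size w + d) (Fword w * u).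
Proof.
elim=> {u} [w' w'd||u v _ IHu _ IHv|a u _ IH].
- by rewrite -Fword_cat; apply: Ufilt_word; rewrite size_cat ltn_add2l.
- by rewrite mulr0; apply: Ufilt_0.
- by rewrite mulrDr; apply: Ufilt_D.
- by rewrite -scalerAr; apply: Ufilt_Z.
Qed.

Lemma Ufilt_wordr d w u : Ufilt d u -> Ufilt (d + size w) (u * Fword w).
Proof.
elim=> {u} [w' w'd||u v _ IHu _ IHv|a u _ IH].
- by rewrite -Fword_cat; apply: Ufilt_word; rewrite size_cat ltn_add2r.
- by rewrite mul0r; apply: Ufilt_0.
- by rewrite mulrDl; apply: Ufilt_D.
- by rewrite -scalerAl; apply: Ufilt_Z.
Qed.

Lemma Ufilt_mul d e u v : Ufilt d u -> Ufilt e v -> exists f, Ufilt f (u * v).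
Proof.
move=> du; elim=> {v} [w _||v v' _ [f fP] _ [g gP]|a v _ [f fP]].
- by exists (d + size w)%N; exact: Ufilt_wordr.
- by exists 0%N; rewrite mulr0; exact: Ufilt_0.
- exists (maxn f g); rewrite mulrDr; apply: Ufilt_D.
    by apply: Ufilt_le fP; exact: leq_maxl.
  by apply: Ufilt_le gP; exact: leq_maxr.
- by exists f; rewrite -scalerAr; exact: Ufilt_Z.
Qed.

Lemma Fword1 i j : Fword [:: (i, j)] = F i j.
Proof. by rewrite /Fword big_seq1. Qed.

Lemma Ufilt_tensor_action i j k l : Ufilt 2 (tensor_action F i j k l).
Proof.
have F2 a b n : Ufilt 2 (F a b *+ n).
  by rewrite -scaler_nat -Fword1; apply/Ufilt_Z/Ufilt_word.
rewrite /tensor_action -scaleN1r scalerA.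
by apply: Ufilt_D; [|apply: Ufilt_Z]; apply: Ufilt_D.
Qed.

(** Up to shorter words the generators supercommute: each exchange leaves a bracket, which is a
    single letter in place of two. *)
Lemma Fword_move i j w :
  Ufilt (size w).+1 (F i j * Fword w - (-1) ^+ (par i j && wpar w) *: (Fword w * F i j)).
Proof.
elim: w => [|[k l] w IH].
  rewrite /Fword /wpar !big_nil andbF scale1r mulr1 mul1r subrr; exact: Ufilt_0.
have -> : Fword ((k, l) :: w) = F k l * Fword w by rewrite /Fword big_cons.
have -> : wpar ((k, l) :: w) = par k l (+) wpar w by rewrite /wpar big_cons.
set s := (-1) ^+ (par i j && par k l) : K.
have -> : F i j * (F k l * Fword w)
    - (-1) ^+ (par i j && (par k l (+) wpar w)) *: (F k l * Fword w * F i j)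
  = s *: (F k l * (F i j * Fword w - (-1) ^+ (par i j && wpar w) *: (Fword w * F i j)))
    + tensor_action F i j k l * Fword w.
  rewrite mulrA [F i j * F k l](sbrE (par i j) (par k l)) F_sbr mulrDl.
  rewrite addrAC; congr (_ + _); rewrite mulrBr scalerBr -scalerAl !mulrA.
  by rewrite -scalerAr scalerA -signr_addb -andb_addr mulrA.
apply: Ufilt_D; last exact: (Ufilt_wordr w (Ufilt_tensor_action _ _ _ _)).
by apply: Ufilt_Z; rewrite -[F k l]Fword1; exact: (Ufilt_wordl [:: (k, l)] IH).
Qed.

End Words.

Section EnvelopingAlgebra.
Variables (R : realType) (N : nat).
Local Notation C := R[i].
Local Notation qN := (subvs_of (queer R N)).
Local Notation U := (Uq R N).
Implicit Types (i j k l : 'I_(N + N)).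

Lemma Fmx_mul i j k l : Fmx R i j *m Fmx R k l =
  Fmx R i l *+ (j == k) + Fmx R (opp_idx i) l *+ (opp_idx j == k).
Proof.
rewrite /Fmx mulmxDl !mulmxDr !mul_delta_mx_cond opp_idxK.
rewrite (inj_eq (inv_inj (@opp_idxK N))) opp_idx_eq !mulrnDl.
set a := delta_mx i l *+ _; set b := _ *+ _; set c := _ *+ _; set d := _ *+ _.
by rewrite [c + d]addrC addrACA [b + c]addrC.
Qed.

Lemma Fmx_opp i j : Fmx R (opp_idx i) (opp_idx j) = Fmx R i j.
Proof. by rewrite /Fmx !opp_idxK addrC. Qed.

Lemma Fmx_homogeneous i j : homogeneous (par i j) (Fmx R i j).
Proof.
move=> a b; rewrite !mxE; case: andP => [[/eqP-> /eqP->]|_] //.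
rewrite add0r; case: andP => [[/eqP-> /eqP->] _|_]; last by rewrite eqxx.
by rewrite /par !bar_opp addbN addNb negbK.
Qed.

Definition Fq i j : qN := Subvs (Fmx_queer R i j).

Lemma piU_scale a (t : freealg R N) : piU (a *: t) = a *: piU t.
Proof. exact: piU_Z. Qed.

Lemma piU_mul (s t : freealg R N) : piU (s * t) = piU s * piU t.
Proof. exact: piU_M. Qed.

Lemma Uiota_linear : linear (@Uiota R N).
Proof.
move=> a x y; apply/eqP; rewrite /Uiota -piU_scale -piU_D piU_eq.
by apply/UidealP/Uideal_rel/Urel_linear.
Qed.

HB.instance Definition _ := GRing.isLinear.Build C qN U *:%R (@Uiota R N)
  Uiota_linear.

Lemma UiotaD : {morph @Uiota R N : x y / x + y}. Proof. exact: linearD. Qed.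
Lemma UiotaB : {morph @Uiota R N : x y / x - y}. Proof. exact: linearB. Qed.
Lemma UiotaZ a : {morph @Uiota R N : x / a *: x}. Proof. exact: linearZ. Qed.
Lemma UiotaMn n : {morph @Uiota R N : x / x *+ n}. Proof. exact: linearMn. Qed.
Definition Uiota_simp := (UiotaB, UiotaD, UiotaZ, UiotaMn).

Lemma vsvalD : {morph (vsval : qN -> 'M_(N + N)) : x y / x + y}. Proof. exact: linearD. Qed.
Lemma vsvalB : {morph (vsval : qN -> 'M_(N + N)) : x y / x - y}. Proof. exact: linearB. Qed.
Lemma vsvalZ a : {morph (vsval : qN -> 'M_(N + N)) : x / a *: x}. Proof. exact: linearZ. Qed.
Lemma vsvalMn n : {morph (vsval : qN -> 'M_(N + N)) : x / x *+ n}. Proof. exact: linearMn. Qed.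
Definition vsval_simp := (vsvalB, vsvalD, vsvalZ, vsvalMn).

Lemma Uiota_sum I r (P : pred I) (f : I -> qN) :
  Uiota (\sum_(x <- r | P x) f x) = \sum_(x <- r | P x) Uiota (f x).
Proof. exact: linear_sum. Qed.

Lemma vsval_sum I r (P : pred I) (f : I -> qN) :
  vsval (\sum_(x <- r | P x) f x) = \sum_(x <- r | P x) vsval (f x).
Proof. exact: linear_sum. Qed.

Lemma Uiota_sbr p q (x y z : qN) :
  homogeneous p (vsval x) -> homogeneous q (vsval y) ->
  vsval z = superbracket p q (vsval x) (vsval y) ->
  sbr p q (Uiota x) (Uiota y) = Uiota z.
Proof.
move=> hx hy hz; apply/eqP; rewrite /sbr /Uiota.
rewrite -!piU_mul -piU_scale -[- piU _]scaleN1r -piU_scale -piU_D piU_eq scaleN1r.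
by apply/UidealP/Uideal_rel/Urel_bracket.
Qed.

Lemma Fgen_opp i j : Fgen R (opp_idx i) (opp_idx j) = Fgen R i j.
Proof. by rewrite /Fgen; congr Uiota; apply/val_inj; rewrite /= Fmx_opp. Qed.

Lemma Fgen_sbr i j k l :
  sbr (par i j) (par k l) (Fgen R i j) (Fgen R k l) = tensor_action (@Fgen R N) i j k l.
Proof.
pose z : qN := Fq i l *+ (j == k) + Fq (opp_idx i) l *+ (opp_idx j == k)
   - (-1) ^+ (par i j && par k l) *: (Fq k j *+ (i == l) + Fq k (opp_idx j) *+ (opp_idx i == l)).
rewrite (@Uiota_sbr _ _ _ _ z).
- by rewrite /z !Uiota_simp.
- exact: Fmx_homogeneous.
- exact: Fmx_homogeneous.
- rewrite /superbracket /z !vsval_simp /=.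
  rewrite !Fmx_mul; congr (_ - _ *: (_ + _)).
    by rewrite eq_sym.
  rewrite -[Fmx R (opp_idx k) j]Fmx_opp opp_idxK; congr (_ *+ _).
  by rewrite opp_idx_eq eq_sym opp_idx_eq eq_sym.
Qed.

Lemma queer_span (x : qN) : exists c : 'I_(N + N) -> 'I_(N + N) -> C,
  x = \sum_i \sum_j c i j *: Fq i j.
Proof.
have /memv_sumP[v vP xE] : vsval x \in queer R N by exact: subvsP.
have /(_ _)/cid cP i : exists c : 'I_(N + N) -> C, v i = \sum_j c j *: Fmx R i j.
  have /memv_sumP[w wP vE] := vP i isT.
  have /(_ _)/cid dP j : exists d, w j = d *: Fmx R i j.
    by have /vlineP := wP j isT.
  exists (fun j => sval (dP j)); rewrite vE; apply: eq_bigr => j _.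
  by case: (dP j).
exists (fun i => sval (cP i)); apply/val_inj; rewrite /= xE.
rewrite [RHS](linear_sum (vsval : {linear _ -> _})); apply: eq_bigr => i _.
rewrite (linear_sum (vsval : {linear _ -> _})) /=.
by rewrite [LHS](svalP (cP i)).
Qed.

Local Notation F := (@Fgen R N).

Lemma Ufilt_Uiota (x : qN) : Ufilt F 2 (Uiota x).
Proof.
have [c ->] := queer_span x.
rewrite linear_sum; apply: Ufilt_sum => i.
rewrite linear_sum; apply: Ufilt_sum => j.
rewrite /= UiotaZ; apply: Ufilt_Z.
rewrite (_ : Uiota (Fq i j) = Fword F [:: (i, j)]); first exact: Ufilt_word.
by rewrite /Fword big_seq1.
Qed.

Lemma Ufilt_exhaust u : exists d, Ufilt F d u.
Proof.
rewrite -(piU_repr u); move: (repr u) => t.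
have gen (s : seq qN) : exists d, Ufilt F d (piU (mkmalgU (fmonom_of_seq fmonom_key s) 1)).
  elim: s => [|x s [d IH]].
    exists 1%N; rewrite -[piU _]/(piU 1) piU_1.
    have -> : Uone R N = Fword F [::] by rewrite /Fword big_nil.
    exact: Ufilt_word.
  have -> : mkmalgU (fmonom_of_seq fmonom_key (x :: s)) 1 =
      freegen x * mkmalgU (fmonom_of_seq fmonom_key s) 1 :> freealg R N.
    rewrite /freegen [RHS]malgM_def fgmulUU mul1r; congr (mkmalgU _ _).
    by apply/val_inj; rewrite /= fmM fmuE !fmE.
  by rewrite piU_M; exact: (Ufilt_mul (Ufilt_Uiota x) IH).
have -> : t = \sum_(k <- finmap.enum_fset (monalg.msupp t))
    monalg.mcoeff k t *: (mkmalgU k 1 : freealg R N).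
  rewrite {1}[t]monalgE; apply: eq_bigr => k _; apply/malgP => k'.
  by rewrite monalg.mcoeffZ !monalg.mcoeffU mulr_natr.
elim: (finmap.enum_fset _) => [|k s [d IH]].
  have piU0 : piU 0 = 0 :> U by rewrite /piU piE.
  by exists 0%N; rewrite big_nil piU0; exact: Ufilt_0.
rewrite big_cons piU_D piU_Z.
have [e eP] := gen (k : seq _).
exists (maxn d e); apply: Ufilt_D.
  apply: Ufilt_Z; apply: Ufilt_le (leq_maxr _ _) _.
  by rewrite fmE in eP; case: k eP.
exact: Ufilt_le (leq_maxl _ _) IH.
Qed.

End EnvelopingAlgebra.

(** * The Harish-Chandra projection of the cyclic elements *)

(** The target is noncommutative; it is enough that the values of the variables commute with each
    other. *)
Lemma mmap_comm_mul (n : nat) (R : comNzRingType) (S : algType R)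
    (h : 'I_n -> S) (p q : {mpoly R[n]}) :
  (forall i j, GRing.comm (h i) (h j)) ->
  mmap (in_alg S) h (p * q) = mmap (in_alg S) h p * mmap (in_alg S) h q.
Proof.
move=> hC; rewrite [p]mpolyE [q]mpolyE big_distrlr /= !raddf_sum big_distrlr /=.
apply: eq_bigr => m _; rewrite raddf_sum; apply: eq_bigr => m' _.
rewrite -!scalerAl -!scalerAr -mpolyXD !scalerA !mmapZ !mmapX /= !mulr_algl.
rewrite -scalerAl -scalerAr scalerA [LHS]mmapZ mmapX /= mulr_algl.
congr (_ *: _).
rewrite /mmap1 -prodrM_comm => [|i j _ _]; last exact/commrX/commr_sym/commrX.
by apply: eq_bigr => i _; rewrite mnmDE exprD.
Qed.

(* ccoef s i is the image modulo n_- U + U n_+ of the (i, i) entry of the 2s-th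
   power of the matrix of generators, with x i standing for F_ii. *)
Fixpoint ccoef (N : nat) (A : comNzRingType) (x : 'I_N -> A) (s : nat) (i : 'I_N) : A :=
  if s is s'.+1 then
    ccoef x s' i * (x i ^+ 2 - x i) - (\sum_(m < N | (i < m)%N) ccoef x s' m * x m) *+ 2
  else 1.

(** Puts the right-hand sides of the recursions below in a form that can be compared summand by
    summand with a matrix product. *)
Lemma sum_diag_above (V : zmodType) (N : nat) (i : 'I_N) (A : V) (B : 'I_N -> V) :
  A - \sum_(m < N | (i < m)%N) B m =
  \sum_(m < N) (if m == i then A else if (i < m)%N then - B m else 0).
Proof.
rewrite [RHS](bigD1 i) //= eqxx -sumrN; congr (_ + _).
rewrite big_mkcond [RHS]big_mkcond; apply: eq_bigr => m _.
by case: eqVneq => [->|]; rewrite //= ltnn.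
Qed.

Section AbsIdx.
Variable N : nat.
Implicit Types i j : 'I_N.

Definition absi (a : 'I_(N + N)) : 'I_N := match split a with inl i => i | inr i => i end.

Lemma absi_pos i : absi (pos i) = i.
Proof. by rewrite /absi (unsplitK (inl i)). Qed.
Lemma absi_neg i : absi (neg i) = i.
Proof. by rewrite /absi (unsplitK (inr i)). Qed.
Lemma absi_opp a : absi (opp_idx a) = absi a.
Proof. by have [k [->|->]] := pos_neg_cases a; rewrite ?opp_pos ?opp_neg ?absi_pos ?absi_neg. Qed.

Lemma pos_eq i j : (pos i == pos j) = (i == j).
Proof. by apply/eqP/eqP => [/lshift_inj|->]. Qed.
Lemma neg_eq i j : (neg i == neg j) = (i == j).
Proof. by apply/eqP/eqP => [/rshift_inj|->]. Qed.
Lemma pos_neg_eq i j : (pos i == neg j) = false.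
Proof. by apply/eqP => /(congr1 (@bar N)); rewrite bar_pos bar_neg. Qed.
Lemma neg_pos_eq i j : (neg i == pos j) = false.
Proof. by rewrite eq_sym pos_neg_eq. Qed.

Definition idxE := (opp_pos, opp_neg, bar_pos, bar_neg, absi_pos, absi_neg,
  pos_eq, neg_eq, pos_neg_eq, neg_pos_eq).

End AbsIdx.

Section TriangularKernel.
Variables (K : numFieldType) (U : algType K) (N : nat).
Variable F : 'I_(N + N) -> 'I_(N + N) -> U.
Hypothesis F_opp : forall i j, F (opp_idx i) (opp_idx j) = F i j.
Hypothesis F_sbr : forall i j k l,
  sbr (par i j) (par k l) (F i j) (F k l) = tensor_action F i j k l.
Local Notation X := (Xpow F).
Implicit Types (i j m : 'I_N) (u v : U).

Definition ev : {mpoly K[N]} -> U := mmap (in_alg U) (fun i => F (pos i) (pos i)).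

(* n_- U + U n_+ in terms of the generators; in the super-commutation relations
   only the absolute values of the indices matter. *)
Inductive HCker : U -> Prop :=
| HCker_0 : HCker 0
| HCker_D u v : HCker u -> HCker v -> HCker (u + v)
| HCker_l a b u : (absi b < absi a)%N -> HCker (F a b * u)
| HCker_r u a b : (absi a < absi b)%N -> HCker (u * F a b).

Lemma HCkerZ x u : HCker u -> HCker (x *: u).
Proof.
elim=> {u} [|u v _ IHu _ IHv|a b u ab|u a b ab].
- by rewrite scaler0; exact: HCker_0.
- by rewrite scalerDr; exact: HCker_D.
- by rewrite scalerAr; exact: HCker_l.
- by rewrite scalerAl; exact: HCker_r.
Qed.

Lemma HCkerN u : HCker u -> HCker (- u).
Proof. by rewrite -scaleN1r; exact: HCkerZ. Qed.

Lemma HCkerB u v : HCker u -> HCker v -> HCker (u - v).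
Proof. by move=> hu hv; apply/HCker_D/HCkerN. Qed.

Lemma HCkerMn n u : HCker u -> HCker (u *+ n).
Proof. by rewrite -scaler_nat; exact: HCkerZ. Qed.

Lemma HCker_sum (I : finType) (P : pred I) (f : I -> U) :
  (forall x, P x -> HCker (f x)) -> HCker (\sum_(x | P x) f x).
Proof. by move=> fP; apply: big_rec => [|x y Px]; [exact: HCker_0 | apply/HCker_D/fP]. Qed.

(** With |a| = |b| the generator F_ab lies in the Cartan subalgebra, even or odd, which normalises
    n_+; the next lemma is the same for n_-. *)
Lemma tensor_action_HCkerl u a b c d : absi a = absi b ->
  (absi c < absi d)%N -> HCker (u * tensor_action F c d a b).
Proof.
move=> ab cd; rewrite /tensor_action mulrBr mulrDr -scalerAr mulrDr !mulrnAr.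
apply: HCkerB; [|apply: HCkerZ]; apply: HCker_D; rewrite mulrb; case: eqP => e;
  try exact: HCker_0; apply: HCker_r.
- by rewrite -ab -e.
- by rewrite absi_opp -ab -e absi_opp.
- by rewrite ab -e.
- by rewrite absi_opp ab -e absi_opp.
Qed.

Lemma tensor_action_HCkerr u a b c d : absi a = absi b ->
  (absi d < absi c)%N -> HCker (tensor_action F c d a b * u).
Proof.
move=> ab cd; rewrite /tensor_action mulrBl mulrDl -scalerAl mulrDl !mulrnAl.
apply: HCkerB; [|apply: HCkerZ]; apply: HCker_D; rewrite mulrb; case: eqP => e;
  try exact: HCker_0; apply: HCker_l.
- by rewrite -ab -e.
- by rewrite absi_opp -ab -e absi_opp.
- by rewrite ab -e.
- by rewrite absi_opp ab -e absi_opp.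
Qed.

(** [HCker] is the sum of a right and a left ideal, so stability under a multiplication has to be
    proved. For the Cartan generators it holds because they normalise n_+ and n_-. *)
Lemma HCker_mulr u a b : absi a = absi b -> HCker u -> HCker (u * F a b).
Proof.
move=> ab; elim=> {u} [|u v _ IHu _ IHv|c d u cd|u c d cd].
- by rewrite mul0r; exact: HCker_0.
- by rewrite mulrDl; exact: HCker_D.
- by rewrite -mulrA; exact: HCker_l.
- rewrite -mulrA [F c d * _](sbrE (par c d) (par a b)) mulrDr F_sbr -scalerAr mulrA.
  by apply: HCker_D; [exact/HCkerZ/HCker_r | exact: tensor_action_HCkerl].
Qed.

Lemma HCker_mull u a b : absi a = absi b -> HCker u -> HCker (F a b * u).
Proof.
move=> ab; elim=> {u} [|u v _ IHu _ IHv|c d u cd|u c d cd].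
- by rewrite mulr0; exact: HCker_0.
- by rewrite mulrDr; exact: HCker_D.
- have -> : F a b * (F c d * u) = (-1) ^+ (par c d && par a b) *:
     (F c d * (F a b * u)) - (-1) ^+ (par c d && par a b) *:
     (tensor_action F c d a b * u).
    rewrite [in RHS]mulrA [F c d * F a b](sbrE (par c d) (par a b)) mulrDl F_sbr -scalerAl.
    by rewrite scalerDr addrK scalerA -signr_addb addbb scale1r mulrA.
  by apply: HCkerB; apply: HCkerZ; [exact: HCker_l | exact: tensor_action_HCkerr].
- by rewrite mulrA; exact: HCker_r.
Qed.

Lemma FgenNN i j : F (neg i) (neg j) = F (pos i) (pos j).
Proof. by rewrite -!opp_pos F_opp. Qed.

Lemma FgenNP i j : F (neg i) (pos j) = F (pos i) (neg j).
Proof. by rewrite -(F_opp (pos i)) opp_pos opp_neg. Qed.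

Lemma cartan_comm i j : GRing.comm (F (pos i) (pos i)) (F (pos j) (pos j)).
Proof.
apply/eqP; rewrite -subr_eq0.
have := F_sbr (pos i) (pos i) (pos j) (pos j).
rewrite /sbr /tensor_action !par_diag /= !scale1r !idxE => e; apply/eqP; apply: etrans e _.
by case: eqVneq => [->|_]; rewrite !mulr0n !addr0 ?subrr.
Qed.

Lemma evM p q : ev (p * q) = ev p * ev q.
Proof. exact/mmap_comm_mul/cartan_comm. Qed.

Lemma evX i : ev 'X_i = F (pos i) (pos i).
Proof. by rewrite /ev mmapX mmap1U. Qed.

Lemma ev1 : ev 1 = 1.
Proof. by rewrite /ev (mmapC _ _ 1) /= scale1r. Qed.

Lemma evZ a p : ev (a *: p) = a *: ev p.
Proof. by rewrite /ev mmapZ /= mulr_algl. Qed.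

Lemma evD : {morph ev : p q / p + q}. Proof. exact: mmapD. Qed.
Lemma evB : {morph ev : p q / p - q}. Proof. exact: mmapB. Qed.
Lemma evMn n : {morph ev : p / p *+ n}. Proof. exact: mmapMn. Qed.
Lemma ev_sum I r (P : pred I) (f : I -> {mpoly K[N]}) :
  ev (\sum_(x <- r | P x) f x) = \sum_(x <- r | P x) ev (f x).
Proof. exact: raddf_sum. Qed.

(** Half of [F_{i,-i}, F_{i,-i}] = 2 F_ii. The linear term - x_i in the recursion of [ccoef] comes
    from here. *)
Lemma odd_cartan_sqr i : F (pos i) (neg i) * F (pos i) (neg i) = F (pos i) (pos i).
Proof.
have := F_sbr (pos i) (neg i) (pos i) (neg i).
rewrite /sbr /tensor_action /par !idxE /= expr1 !scaleN1r opprK !mulr0n !eqxx !mulr1n.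
rewrite !add0r FgenNN opprK -!mulr2n => /eqP.
rewrite -subr_eq0 -mulrnBl -scaler_nat scaler_eq0 pnatr_eq0 /= subr_eq0.
by move/eqP.
Qed.

Lemma cartan_odd_comm i : F (pos i) (neg i) * F (pos i) (pos i) =
  F (pos i) (pos i) * F (pos i) (neg i).
Proof. by rewrite -odd_cartan_sqr mulrA. Qed.

Lemma XpowNN n i : X n (neg i) (neg i) = (-1) ^+ n *: X n (pos i) (pos i).
Proof. by rewrite -(Xpow_opp F_opp) opp_pos. Qed.

Lemma XpowNP n i : X n (neg i) (pos i) = (-1) ^+ n *: X n (pos i) (neg i).
Proof.
by rewrite -(Xpow_opp F_opp) opp_pos opp_neg.
Qed.

(** F_ab lies in n_-; moved to the left of X it vanishes modulo [HCker], and only the bracket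
    remains. *)
Lemma Xpow_step_lower n (c a b : 'I_(N + N)) : (absi b < absi a)%N ->
  HCker (X n c a * F a b +
     (-1) ^+ (par a b && par c a) *: tensor_action (X n) a b c a).
Proof.
move=> ab; rewrite -(Xpow_sbr F_sbr).
rewrite /sbr scalerBr scalerA -signr_addb addbb scale1r addrC subrK.
exact/HCkerZ/HCker_l.
Qed.

Lemma Xpow_diag_rec n i :
  HCker (X n.+1 (pos i) (pos i) -
    (X n (pos i) (pos i) * F (pos i) (pos i) - X n (pos i) (neg i) * F (pos i) (neg i)
      - \sum_(m < N | (i < m)%N) (1 + (-1) ^+ n) *: X n (pos m) (pos m))).
Proof.
rewrite sum_diag_above /= sum_posneg -sumrB; apply: HCker_sum => m _.
rewrite !idxE !expr1 expr0 scale1r scaleN1r; case: eqVneq => [->|mi].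
  by rewrite FgenNP subrr; exact: HCker_0.
case: ifP => im.
  (* The indices m and -m are treated together: their two X_ii terms cancel, and X_mm + X_{-m,-m} =
     (1 + (-1)^n) X_mm is left. *)
  have h1 := @Xpow_step_lower n (pos i) (pos m) (pos i).
  have h2 := @Xpow_step_lower n (pos i) (neg m) (pos i).
  rewrite !idxE in h1 h2; have := HCkerB (h1 im) (h2 im).
  congr HCker; rewrite /tensor_action /par !idxE /= !scale1r !eqxx !(mulr0n, mulr1n, addr0).
  rewrite expr1 !scaleN1r opprK opprB scalerDl scale1r XpowNN.
  set D := _ *: _; rewrite opprK [D + _ - _]addrAC addrA [X in X + _ = _]addrAC.
  by rewrite -[LHS]addrA subrK [D - _]addrC !addrA addrAC.
(* For m < i the last factor lies in n_+. *)
rewrite subr0; apply: HCkerB; apply: HCker_r; rewrite !idxE; move: im mi;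
  rewrite -val_eqE /=; case: ltngtP => //.
Qed.

Lemma Xpow_odd_rec n i :
  HCker (X n.+1 (pos i) (neg i) -
    (X n (pos i) (pos i) * F (pos i) (neg i) - X n (pos i) (neg i) * F (pos i) (pos i)
      - \sum_(m < N | (i < m)%N) ((-1) ^+ n - 1) *: X n (pos m) (neg m))).
Proof.
rewrite sum_diag_above /= sum_posneg -sumrB; apply: HCker_sum => m _.
rewrite !idxE !expr1 expr0 scale1r scaleN1r; case: eqVneq => [->|mi].
  by rewrite FgenNN subrr; exact: HCker_0.
case: ifP => im.
  have h1 := @Xpow_step_lower n (pos i) (pos m) (neg i).
  have h2 := @Xpow_step_lower n (pos i) (neg m) (neg i).
  rewrite !idxE in h1 h2; have := HCkerB (h1 im) (h2 im).
  congr HCker; rewrite /tensor_action /par !idxE /= !scale1r !eqxx !(mulr0n, mulr1n, addr0, add0r).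
  rewrite scalerBl scale1r XpowNP.
  by rewrite opprK opprD addrACA opprB [X in _ + X = _]addrA subrK.
rewrite subr0; apply: HCkerB; apply: HCker_r; rewrite !idxE; move: im mi;
  rewrite -val_eqE /=; case: ltngtP => //.
Qed.

Definition eqHC u v := HCker (u - v).

Lemma eqHC_refl u : eqHC u u.
Proof. by rewrite /eqHC subrr; exact: HCker_0. Qed.

Lemma eqHC_trans v u w : eqHC u v -> eqHC v w -> eqHC u w.
Proof. by move=> uv vw; have := HCker_D uv vw; rewrite addrA subrK. Qed.

Lemma eqHC_B u u' v v' : eqHC u u' -> eqHC v v' -> eqHC (u - v) (u' - v').
Proof. by move=> h h'; rewrite /eqHC opprD addrACA -opprD; exact: HCkerB. Qed.

Lemma eqHC_Z a u u' : eqHC u u' -> eqHC (a *: u) (a *: u').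
Proof. by move=> h; rewrite /eqHC -scalerBr; exact: HCkerZ. Qed.

Lemma eqHC_sum (I : finType) (P : pred I) (f g : I -> U) :
  (forall x, P x -> eqHC (f x) (g x)) ->
  eqHC (\sum_(x | P x) f x) (\sum_(x | P x) g x).
Proof. by move=> h; rewrite /eqHC -sumrB; exact: HCker_sum. Qed.

Lemma eqHC_mulr u u' (a b : 'I_(N + N)) : absi a = absi b -> eqHC u u' ->
  eqHC (u * F a b) (u' * F a b).
Proof. by move=> ab h; rewrite /eqHC -mulrBl; exact: HCker_mulr. Qed.

Local Notation e := (ccoef (fun i => 'X_i : {mpoly K[N]})).

(** The diagonal entries depend on the (i,-i) entries, so both are followed. The factor 1 + (-1)^n
    is 2 or 0 according to parity, hence [ccoef] advances once in two multiplications. *)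
Lemma Xpow_HC s i :
  [/\ eqHC (X s.*2 (pos i) (pos i)) (ev (e s i * 'X_i)),
      eqHC (X s.*2 (pos i) (neg i)) (ev (e s i) * F (pos i) (neg i)),
      eqHC (X s.*2.+1 (pos i) (pos i)) (ev (e s.+1 i)) &
      eqHC (X s.*2.+1 (pos i) (neg i)) 0].
Proof.
have odd_step t : (forall i, eqHC (X t.*2 (pos i) (pos i)) (ev (e t i * 'X_i)) /\
    eqHC (X t.*2 (pos i) (neg i)) (ev (e t i) * F (pos i) (neg i))) ->
  forall i, eqHC (X t.*2.+1 (pos i) (pos i)) (ev (e t.+1 i)) /\
      eqHC (X t.*2.+1 (pos i) (neg i)) 0.
  move=> IH {}i; have [h1 h2] := IH i; split.
    apply: eqHC_trans (@Xpow_diag_rec _ i) _.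
    rewrite /= mulrBr expr2 mulrA 2!evB evMn !evM evX ev_sum -sumrMnl.
    apply: eqHC_B; first apply: eqHC_B.
    - by rewrite -evX -evM evX; apply: eqHC_mulr h1; rewrite !idxE.
    - rewrite -[F (pos i) (pos i)]odd_cartan_sqr mulrA.
      by apply: eqHC_mulr h2; rewrite !idxE.
    - apply: eqHC_sum => m _; have [hm _] := IH m.
      rewrite -muln2 exprM sqrr_sign -[1 + 1]/(2%:R) scaler_nat.
      by rewrite /eqHC -mulrnBl muln2; exact: HCkerMn.
  apply: eqHC_trans (@Xpow_odd_rec _ i) _.
  rewrite -muln2 exprM sqrr_sign subrr muln2 big1 => [|m _]; last by rewrite scale0r.
  (* The two products in the recursion have the same image, because F_ii commutes with F_{i,-i}. *)
  rewrite subr0 -[0](subrr (ev (e t i) * F (pos i) (pos i) * F (pos i) (neg i))).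
  apply: eqHC_B.
    by rewrite -evX -evM; apply: eqHC_mulr h1; rewrite !idxE.
  rewrite -mulrA -cartan_odd_comm mulrA.
  by apply: eqHC_mulr h2; rewrite !idxE.
have even_ok t : forall i, eqHC (X t.*2 (pos i) (pos i)) (ev (e t i * 'X_i)) /\
    eqHC (X t.*2 (pos i) (neg i)) (ev (e t i) * F (pos i) (neg i)).
  elim: t => [|t IH] {}i.
    by rewrite /= mul1r evX ev1 mul1r; split; exact: eqHC_refl.
  have [h1 h2] := odd_step t IH i; rewrite doubleS; split.
    apply: eqHC_trans (@Xpow_diag_rec _ i) _.
    rewrite big1 => [|m _]; last first.
      by rewrite exprS -muln2 exprM sqrr_sign mulr1 subrr scale0r.
    have -> : ev (e t.+1 i * 'X_i) =
        ev (e t.+1 i) * F (pos i) (pos i) - 0 * F (pos i) (neg i).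
      by rewrite evM evX mul0r subr0.
    rewrite subr0.
    by apply: eqHC_B; apply: eqHC_mulr; rewrite ?idxE.
  apply: eqHC_trans (@Xpow_odd_rec _ i) _.
  have -> : ev (e t.+1 i) * F (pos i) (neg i) =
    ev (e t.+1 i) * F (pos i) (neg i) - 0 * F (pos i) (pos i)
     - \sum_(m < N | (i < m)%N) ((-1) ^+ t.*2.+1 - 1) *: (0 : U).
    by rewrite mul0r subr0 big1 ?subr0 // => m _; rewrite scaler0.
  apply: eqHC_B; first by apply: eqHC_B; apply: eqHC_mulr; rewrite ?idxE.
  apply: eqHC_sum => m _; apply: eqHC_Z.
  by have [] := odd_step t IH m.
have [? ?] := even_ok s i; have [? ?] := odd_step s (even_ok s) i.
by split.
Qed.

Lemma HCker_ev p u : HCker u -> HCker (ev p * u).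
Proof.
move=> hu; rewrite [p]mpolyE ev_sum mulr_suml.
elim: (msupp p) => [|m s IH]; first by rewrite big_nil; exact: HCker_0.
rewrite big_cons; apply: HCker_D IH; rewrite evZ -scalerAl; apply: HCkerZ.
rewrite /ev mmapX /mmap1.
elim/big_rec: _ => [|i x _ IH]; first by rewrite mul1r.
rewrite -mulrA; elim: (m i) => [|n IHn]; first by rewrite mul1r.
by rewrite exprS -mulrA; apply: HCker_mull.
Qed.

Lemma Xpow_trace_HC s : eqHC (\sum_k X s.*2 k k) (ev ((\sum_i e s i * 'X_i) *+ 2)).
Proof.
rewrite sum_posneg evMn ev_sum -sumrMnl.
apply: eqHC_sum => i _; rewrite XpowNN -muln2 exprM sqrr_sign scale1r muln2.
rewrite -mulr2n /eqHC -mulrnBl; apply: HCkerMn.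
by have [] := Xpow_HC s i.
Qed.

End TriangularKernel.

(** * The centre in the superalgebra sense *)

Section Center.
Variables (R : realType) (N : nat).
Local Notation C := R[i].
Local Notation U := (Uq R N).
Implicit Types (i j k l : 'I_(N + N)) (z u v : U).

Lemma Uhomogeneous_Fgen i j : Uhomogeneous (par i j) (Fgen R i j).
Proof. exact/Uhomogeneous_gen/Fmx_homogeneous. Qed.

Lemma Uhomogeneous_sum p (I : finType) (f : I -> U) :
  (forall x, Uhomogeneous p (f x)) -> Uhomogeneous p (\sum_x f x).
Proof.
by move=> fP; apply: big_rec => [|x y _];
  [exact: Uhomogeneous_0 | exact: Uhomogeneous_D].
Qed.

Lemma Uhomogeneous_Xpow n k l : Uhomogeneous (par k l) (Xpow (@Fgen R N) n k l).
Proof.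
elim: n l => [|n IH] l; first exact: Uhomogeneous_Fgen.
apply: Uhomogeneous_sum => m; apply: Uhomogeneous_Z.
have -> : par k l = par k m (+) par m l.
  by rewrite /par addbA -(addbA (bar k)) addbb addbF.
exact: Uhomogeneous_M (IH m) (Uhomogeneous_Fgen _ _).
Qed.

Lemma comm_Fgen_all z : (forall i j, Fgen R i j * z = z * Fgen R i j) ->
  forall u, z * u = u * z.
Proof.
move=> zF u; have [d] := Ufilt_exhaust u; elim=> {u} [w _||u v _ IHu _ IHv|a u _ IH].
- rewrite /Fword; elim: w => [|x w IH]; first by rewrite big_nil mulr1 mul1r.
  by rewrite big_cons mulrA -zF -!mulrA IH.
- by rewrite mulr0 mul0r.
- by rewrite mulrDl mulrDr IHu IHv.
- by rewrite -scalerAl -scalerAr IH.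
Qed.

Lemma in_center_even z : Uhomogeneous false z ->
  (forall i j, Fgen R i j * z = z * Fgen R i j) -> in_center z.
Proof.
move=> z0 zF; exists z, 0; split; rewrite ?addr0 //; first exact: Uhomogeneous_0.
by move=> p u _; rewrite mul0r mulr0 scaler0; split=> //; apply: comm_Fgen_all.
Qed.

Lemma cyclic_elt_trace n : cyclic_elt R N n.+1 = \sum_k Xpow (@Fgen R N) n k k.
Proof. by rewrite Xpow_trace. Qed.

Lemma in_center_cyclic n : in_center (cyclic_elt R N n.+1).
Proof.
rewrite cyclic_elt_trace; apply: in_center_even.
  apply: Uhomogeneous_sum => k; rewrite -(par_diag k); exact: Uhomogeneous_Xpow.
by move=> i j; apply: Xpow_trace_comm => *; apply: Fgen_sbr.
Qed.

Lemma in_center1 : in_center (1 : U).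
Proof.
exists 1, 0; split; rewrite ?addr0 //; [exact: Uhomogeneous_1 | exact: Uhomogeneous_0|].
by move=> p u _; rewrite mul1r mulr1 mul0r mulr0 scaler0.
Qed.

Lemma in_centerD z z' : in_center z -> in_center z' -> in_center (z + z').
Proof.
move=> [z0 [z1 [-> h0 h1 hz]]] [y0 [y1 [-> k0 k1 hy]]].
exists (z0 + y0), (z1 + y1); split; rewrite 1?addrACA //; try exact: Uhomogeneous_D.
move=> p u up; have [a b] := hz p u up; have [c d] := hy p u up.
by rewrite !mulrDl !mulrDr a b c d scalerDr.
Qed.

Lemma in_centerZ a z : in_center z -> in_center (a *: z).
Proof.
move=> [z0 [z1 [-> h0 h1 hz]]].
exists (a *: z0), (a *: z1); split; rewrite ?scalerDr //; try exact: Uhomogeneous_Z.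
move=> p u up; have [e f] := hz p u up.
by rewrite -!scalerAl -!scalerAr e f !scalerA mulrC.
Qed.

Lemma in_centerM z z' : in_center z -> in_center z' -> in_center (z * z').
Proof.
move=> [z0 [z1 [-> h0 h1 hz]]] [y0 [y1 [-> k0 k1 hy]]].
exists (z0 * y0 + z1 * y1), (z0 * y1 + z1 * y0); split.
- by rewrite mulrDl !mulrDr [z1 * y0 + _]addrC addrACA.
- by apply: Uhomogeneous_D; [apply: (@Uhomogeneous_M _ _ false false)
  | apply: (@Uhomogeneous_M _ _ true true)].
- by apply: Uhomogeneous_D; [apply: (@Uhomogeneous_M _ _ false true)
  | apply: (@Uhomogeneous_M _ _ true false)].
- move=> p u up; have [a b] := hz p u up; have [c d] := hy p u up.
  rewrite !mulrDl !mulrDr -!mulrA c d -!scalerAr !mulrA a b -!scalerAl scalerA.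
  by rewrite -signr_addb addbb scale1r scalerDr.
Qed.

End Center.

(** * Multiplicativity of the Harish-Chandra images *)

Section HarishChandra.
Variables (R : realType) (N : nat).
Local Notation C := R[i].
Local Notation U := (Uq R N).
Local Notation qN := (subvs_of (queer R N)).
Local Notation F := (@Fgen R N).
Local Notation HCker := (@HCker C U N F).
Local Notation ev := (@ev C U N F).
Implicit Types (z u v : U).

Lemma root_span (P : rel 'I_N) (x : qN) :
  vsval x \in (\sum_(i < N) \sum_(j < N | P i j)
     (<[Fmx R (pos i) (pos j)]> + <[Fmx R (pos i) (neg j)]>))%VS ->
  exists c : 'I_(N + N) -> 'I_(N + N) -> C,
    x = \sum_a \sum_(b | P (absi a) (absi b)) c a b *: Fq R a b.
Proof.
move=> /memv_sumP[v vP xE].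
have /(_ _)/cid cP i : exists c : 'I_(N + N) -> C,
    v i = \sum_(b | P i (absi b)) c b *: Fmx R (pos i) b.
  have /memv_sumP[w wP vE] := vP i isT.
  have /(_ _)/cid dP j : exists d : C * C, P i j ->
     w j = d.1 *: Fmx R (pos i) (pos j) + d.2 *: Fmx R (pos i) (neg j).
    case Pij: (P i j); last by exists 0.
    have /memv_addP[y /vlineP[d ->] [y' /vlineP[d' ->] ->]] := wP j Pij.
    by exists (d, d').
  exists (fun b => if bar b then (sval (dP (absi b))).2 else (sval (dP (absi b))).1).
  rewrite vE [RHS]big_mkcond sum_posneg [LHS]big_mkcond.
  apply: eq_bigr => j _; rewrite absi_pos absi_neg bar_pos bar_neg.
  move: (svalP (dP j)); move: (sval (dP j)) => d dE.
  by case: ifP => [/dE //|_]; rewrite addr0.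
exists (fun a b => if bar a then 0 else sval (cP (absi a)) b).
apply/val_inj; rewrite /= xE sum_posneg vsval_sum.
apply: eq_bigr => i _; rewrite [v i](svalP (cP i)) vsvalD !vsval_sum /=.
rewrite absi_pos absi_neg bar_pos bar_neg [X in _ + X]big1 ?addr0.
  by apply: eq_bigr.
by move=> b _; rewrite scale0r.
Qed.

Lemma nminusU_UnplusP u : nminusU_Unplus u <-> HCker u.
Proof.
split.
  elim=> {u} [|u v _ IHu _ IHv|x u|u x].
  - exact: HCker_0.
  - exact: HCker_D.
  - move=> /(@root_span (fun i j => (j < i)%N))[c ->].
    rewrite Uiota_sum mulr_suml; apply: HCker_sum => a _.
    rewrite Uiota_sum mulr_suml; apply: HCker_sum => b ab.
    by rewrite UiotaZ -scalerAl; apply/HCkerZ/HCker_l.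
  - move=> /(@root_span (fun i j => (i < j)%N))[c ->].
    rewrite Uiota_sum mulr_sumr; apply: HCker_sum => a _.
    rewrite Uiota_sum mulr_sumr; apply: HCker_sum => b ab.
    by rewrite UiotaZ -scalerAr; apply/HCkerZ/HCker_r.
have mem (P : rel 'I_N) a b : P (absi a) (absi b) ->
   vsval (Fq R a b) \in (\sum_(i < N) \sum_(j < N | P i j)
     (<[Fmx R (pos i) (pos j)]> + <[Fmx R (pos i) (neg j)]>))%VS.
  move=> Pab; apply: (subvP (sumv_sup (absi a) _ (subvv _))) => //.
  apply: (subvP (sumv_sup (absi b) Pab (subvv _))).
  have [i [ia|ia]] := pos_neg_cases a; have [j [jb|jb]] := pos_neg_cases b;
    rewrite ia jb ?absi_pos ?absi_neg /=.
  - exact/(subvP (addvSl _ _))/memv_line.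
  - exact/(subvP (addvSr _ _))/memv_line.
  - by rewrite -Fmx_opp opp_pos opp_neg; exact/(subvP (addvSr _ _))/memv_line.
  - by rewrite -Fmx_opp !opp_neg; exact/(subvP (addvSl _ _))/memv_line.
elim=> {u} [|u v _ IHu _ IHv|a b u ab|u a b ab].
- exact: nUUn_0.
- exact: nUUn_D.
- by apply: nUUn_l; exact: (mem (fun i j => (j < i)%N)).
- by apply: nUUn_r; exact: (mem (fun i j => (i < j)%N)).
Qed.

Lemma HCE z p : HC z p <-> in_center z /\ HCker (z - ev p).
Proof. by split=> -[cz hz]; split=> //; apply/nminusU_UnplusP. Qed.

Lemma HC_cyclic s : HC (cyclic_elt R N s.*2.+1)
  ((\sum_i ccoef (fun i => 'X_i : {mpoly C[N]}) s i * 'X_i) *+ 2).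
Proof.
apply/HCE; split; first exact: in_center_cyclic.
rewrite cyclic_elt_trace; exact: (Xpow_trace_HC (@Fgen_opp R N) (@Fgen_sbr R N)).
Qed.

(** A central factor passes a generator of n_+, up to a sign on its odd component, and so leaves U
    n_+ stable. *)
Lemma HCkerM_center z u : in_center z -> HCker u -> HCker (u * z).
Proof.
move=> [z0 [z1 [-> _ _ zc]]]; elim=> {u} [|u v _ IHu _ IHv|a b u ab|u a b ab].
- by rewrite mul0r; exact: HCker_0.
- by rewrite mulrDl; exact: HCker_D.
- by rewrite -mulrA; exact: HCker_l.
- have [c0 c1] := zc _ _ (Uhomogeneous_Fgen R a b).
  have -> : u * F a b * (z0 + z1) = (u * z0) * F a b +
     ((-1) ^+ par a b *: (u * z1)) * F a b.
    rewrite mulrDr -!mulrA -c0 -scalerAl -!mulrA c1 -scalerAr scalerA.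
    by rewrite -signr_addb addbb scale1r.
  by apply: HCker_D; exact: HCker_r.
Qed.

(** In z z' - p p' = (z - p) z' + p (z' - p') the first term uses that z' is central, the second
    that p lies in the Cartan part. *)
Lemma HCM z z' p p' : HC z p -> HC z' p' -> HC (z * z') (p * p').
Proof.
move=> /HCE[cz hz] /HCE[cz' hz']; apply/HCE; split; first exact: in_centerM.
have -> : z * z' - ev (p * p') = (z - ev p) * z' + ev p * (z' - ev p').
  by rewrite mulrBl mulrBr addrA subrK (evM (@Fgen_sbr R N)).
by apply: HCker_D; [exact: HCkerM_center | exact: (HCker_ev (@Fgen_sbr R N))].
Qed.

Lemma HCD z z' p p' : HC z p -> HC z' p' -> HC (z + z') (p + p').
Proof.
move=> /HCE[cz hz] /HCE[cz' hz']; apply/HCE; split; first exact: in_centerD.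
by rewrite evD opprD addrACA; exact: HCker_D.
Qed.

Lemma HCZ a z p : HC z p -> HC (a *: z) (a *: p).
Proof.
move=> /HCE[cz hz]; apply/HCE; split; first exact: in_centerZ.
by rewrite evZ; exact: eqHC_Z.
Qed.

Lemma HC1 : HC (1 : U) 1.
Proof.
apply/HCE; split; first exact: in_center1.
by rewrite ev1 subrr; exact: HCker_0.
Qed.

Lemma HC_sum I (r : seq I) (P : pred I) (f : I -> U) (g : I -> {mpoly C[N]}) :
  (forall x, P x -> HC (f x) (g x)) ->
  HC (\sum_(x <- r | P x) f x) (\sum_(x <- r | P x) g x).
Proof.
move=> h; elim/big_rec2: _ => [|x q y Px]; last exact/HCD/h.
by rewrite -(scale0r (1 : U)) -(scale0r (1 : {mpoly C[N]})); exact/HCZ/HC1.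
Qed.

End HarishChandra.

(** * Tensor representations *)

Section Extension.
Variables (R : realType) (N : nat).
Local Notation C := R[i].
Local Notation U := (Uq R N).
Local Notation qN := (subvs_of (queer R N)).
Variables (A : nzRingType) (iota : {rmorphism C -> A}) (rho : 'M[C]_(N + N) -> A).
Hypothesis iota_comm : forall c a, iota c * a = a * iota c.
Hypothesis rho_linear : forall a x y, rho (a *: x + y) = iota a * rho x + rho y.
Hypothesis rho_superbracket : forall p q x y, homogeneous p x -> homogeneous q y ->
  rho (superbracket p q x y) = rho x * rho y - (-1) ^+ (p && q) * (rho y * rho x).

Definition rho_monom (m : {fmonom qN}) : A := \prod_(x <- m) rho (vsval x).

Fact rho_monom_mmorphism : mmorphism rho_monom.
Proof.
split=> [m1 m2|]; rewrite /rho_monom.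
  by rewrite fmM big_cat.
by rewrite fm1 big_nil.
Qed.

HB.instance Definition _ := monalg.isMultiplicative.Build {fmonom qN} A rho_monom
  rho_monom_mmorphism.

Definition rho_free : freealg R N -> A := monalg.mmap iota rho_monom.

Lemma rho_freeD : {morph rho_free : s t / s + t}.
Proof. exact: monalg.mmapD. Qed.

Lemma rho_freeB : {morph rho_free : s t / s - t}.
Proof. exact: monalg.mmapB. Qed.

Lemma rho_freeZ a t : rho_free (a *: t) = iota a * rho_free t.
Proof. exact: monalg.mmapZ. Qed.

Lemma rho_free1 : rho_free 1 = 1.
Proof. exact: monalg.mmap1. Qed.

Lemma rho_freeM : {morph rho_free : s t / s * t}.
Proof.
have [h _] := @monalg.commr_mmap_is_multiplicative _ _ _ iota rho_monom
  (fun g m m' => iota_comm _ _).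
exact: h.
Qed.

Lemma rho_free_gen x : rho_free (freegen x) = rho (vsval x).
Proof.
by rewrite /rho_free /freegen monalg.mmapU /= rmorph1 mul1r /rho_monom fmuE /= big_seq1.
Qed.

Lemma rho_free_ideal t : Uideal_gen t -> rho_free t = 0.
Proof.
have := rho_free_gen; have := monalg.mmap0 (f := iota) (h := rho_monom).
have := rho_freeM; have := rho_freeZ; have := rho_freeB; have := rho_freeD.
rewrite -/rho_free; move: rho_free => f fD fB fZ fM f0 f_gen.
elim=> {t} [t [a x y | p q x y z hx hy zE] | | s t _ IHs _ IHt | a t _ IH | a t _ IH].
- apply: etrans (fB _ _) _; rewrite f_gen vsvalD vsvalZ rho_linear; apply/eqP.
  rewrite subr_eq0; apply/eqP/esym; apply: etrans (fD _ _) _.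
  by rewrite f_gen; congr (_ + _); apply: etrans (fZ _ _) _; rewrite f_gen.
- have fgM (u v : qN) : f (freegen u * freegen v) = rho (vsval u) * rho (vsval v).
    by apply: etrans (fM _ _) _; rewrite !f_gen.
  apply: etrans (fB _ _) _; rewrite f_gen zE rho_superbracket //; apply/eqP.
  rewrite subr_eq0; apply/eqP; apply: etrans (fB _ _) _; rewrite fgM.
  congr (_ - _); apply: etrans (fZ _ _) _; by rewrite fgM rmorph_sign.
- exact: f0.
- by apply: etrans (fD _ _) _; rewrite IHs IHt addr0.
- by apply: etrans (fM _ _) _; rewrite IH mulr0.
- by apply: etrans (fM _ _) _; rewrite IH mul0r.
Qed.

(** Evaluation at a representative; independence of the choice is [rho_free_ideal]. *)
Definition rhoU (u : U) : A := rho_free (repr u).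

Lemma rhoU_pi t : rhoU (piU t) = rho_free t.
Proof.
apply/eqP; rewrite -subr_eq0 -rho_freeB; apply/eqP/rho_free_ideal/UidealP.
by rewrite -piU_eq piU_repr.
Qed.

Lemma rhoUD : {morph rhoU : u v / u + v}.
Proof. by move=> u v; rewrite -(piU_repr u) -(piU_repr v) -piU_D !rhoU_pi rho_freeD. Qed.

Lemma rhoUM : {morph rhoU : u v / u * v}.
Proof. by move=> u v; rewrite -(piU_repr u) -(piU_repr v) -piU_mul !rhoU_pi rho_freeM. Qed.

Lemma rhoUZ a u : rhoU (a *: u) = iota a * rhoU u.
Proof. by rewrite -(piU_repr u) -piU_scale !rhoU_pi rho_freeZ. Qed.

Lemma rhoU1 : rhoU 1 = 1.
Proof. by rewrite -[1]piU_1 rhoU_pi rho_free1. Qed.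

Lemma rhoU_iota x : rhoU (Uiota x) = rho (vsval x).
Proof. by rewrite rhoU_pi rho_free_gen. Qed.

End Extension.

(** * Unitary tensor powers of V + 1 *)

Section TensorRep.
Variables (R : realType) (N : nat).
Local Notation C := R[i].
Local Notation U := (Uq R N).
Local Notation gl := 'M[C]_(N + N).
Local Notation F := (@Fgen R N).
Local Notation Ufilt := (@Ufilt C U N F).
Local Notation word := (seq ('I_(N + N) * 'I_(N + N))).

Definition raising (x : gl) := forall i j, x i j != 0 -> (absi i < absi j)%N.

(* A *-representation of U(q_N), modelled on the d-th tensor power of V + 1:
   tP is the parity operator, tpos says that the *-structure is positive
   definite, and tfil m holds for the operators raising the height by at least
   m, so that n_+ acts nilpotently. tpsi is a linear section of the top
   symbol: it kills the words of length less than d and maps those of length d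
   to d! times themselves, up to lower order terms. *)
Record trep (d : nat) := TRep {
  tA : nzRingType;
  tiota : {rmorphism C -> tA};
  tiota_comm : forall c a, tiota c * a = a * tiota c;
  tP : tA;
  tP_sqr : tP * tP = 1;
  tstar : tA -> tA;
  tstarD : {morph tstar : a b / a + b};
  tstarM : forall a b, tstar (a * b) = tstar b * tstar a;
  tstarK : involutive tstar;
  tstar_iota : forall c, tstar (tiota c) = tiota (c^*);
  tstar_P : tstar tP = tP;
  tpos : forall (I : finType) (f : I -> tA),
    \sum_i tstar (f i) * f i = 0 -> forall i, f i = 0;
  trho : gl -> tA;
  trho_linear : forall a x y, trho (a *: x + y) = tiota a * trho x + trho y;
  trho_P : forall p x, homogeneous p x -> tP * trho x = (-1) ^+ p * (trho x * tP);
  trho_superbracket : forall p q x y, homogeneous p x -> homogeneous q y ->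
    trho (superbracket p q x y) = trho x * trho y - (-1) ^+ (p && q) * (trho y * trho x);
  trho_star : forall x, tstar (trho x) = trho (map_mx Num.conj x^T);
  tfil : int -> tA -> Prop;
  tfil0 : forall m, tfil m 0;
  tfilD : forall m a b, tfil m a -> tfil m b -> tfil m (a + b);
  tfilM : forall m n a b, tfil m a -> tfil n b -> tfil (m + n) (a * b);
  tfil_le : forall m n a, (n <= m)%R -> tfil m a -> tfil n a;
  tfil_iota : forall c, tfil 0 (tiota c);
  tfil_P : tfil 0 tP;
  tfil_rho : forall x, raising x -> tfil 1 (trho x);
  tfil_top : exists M, forall a, tfil M a -> a = 0;
  tpsi : tA -> U;
  tpsiD : {morph tpsi : a b / a + b};
  tpsiZ : forall c a, tpsi (tiota c * a) = c *: tpsi a;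
  tpsi_short : forall w : word, (size w < d)%N ->
    tpsi (\prod_(p <- w) trho (Fmx R p.1 p.2)) = 0;
  tpsi_top : forall w : word, size w = d ->
    Ufilt d (tpsi (\prod_(p <- w) trho (Fmx R p.1 p.2)) - d`!%:R *: Fword F w)
}.

Definition trep0 : trep 0.
Proof.
refine (@TRep 0 (C : nzRingType) (idfun : {rmorphism C -> C}) _ 1 _ Num.conj
  _ _ _ _ _ _ (fun=> 0) _ _ _ _ (fun m a => (m <= 0)%R \/ a = 0)
  _ _ _ _ _ _ _ _ (fun c => c *: 1) _ _ _ _).
- by move=> c a; rewrite mulrC.
- by rewrite mulr1.
- exact: rmorphD.
- by move=> a b; rewrite rmorphM mulrC.
- exact: conjCK.
- by [].
- exact: rmorph1.
- move=> I f /eqP; rewrite psumr_eq0 => [|i _]; last by rewrite mulrC -normCK exprn_ge0.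
  move=> /allP f0 i; have := f0 i (mem_index_enum i).
  by rewrite /= mulrC -normCK expf_eq0 /= normr_eq0 => /eqP.
- by move=> a x y; rewrite mulr0 addr0.
- by move=> p x _; rewrite !mul0r !mulr0.
- by move=> p q x y _ _; rewrite mulr0 mulr0 subr0.
- by move=> x; rewrite rmorph0.
- by right.
- move=> m a b [ma|->]; first by left.
  by rewrite add0r.
- move=> m n a b [ma [nb|->]|->]; [left|right|right]; rewrite ?mulr0 ?mul0r //.
  by rewrite -[0]addr0 lerD.
- by move=> m n a nm [m0|->]; [left; apply: le_trans nm m0 | right].
- by left.
- by left.
- by right.
- by exists 1 => a [].
- by move=> a b; rewrite scalerDl.
- by move=> c a; rewrite scalerA.
- by [].
- move=> w /size0nil ->; rewrite /Fword !big_nil fact0 subrr; exact: Ufilt_0.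
Defined.

(* V + 1, where the extra basis vector spans a trivial module: then the unit
   matrix is not the image of an element of q_N. *)
Local Notation glx := 'M[C]_(1 + (N + N)).
Definition ext (x : gl) : glx := block_mx 0 0 0 x.
Definition barx (i : 'I_(1 + (N + N))) : bool := if split i is inr k then bar k else false.
(** The height of a basis vector; raising matrices increase it by at least 1. *)
Definition htx (i : 'I_(1 + (N + N))) : int := if split i is inr k then - (absi k)%:Z else 0.
Definition homx (p : bool) (y : glx) := forall i j, y i j != 0 -> barx i (+) barx j = p.

Lemma ext_mul x y : ext x *m ext y = ext (x *m y).
Proof. by rewrite /ext mulmx_block !(mulmx0, mul0mx, addr0, add0r). Qed.

Lemma ext_linear a x y : ext (a *: x + y) = a *: ext x + ext y.
Proof. by rewrite /ext scale_block_mx add_block_mx !(scaler0, addr0). Qed.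

Lemma ext_nz x i j : ext x i j != 0 -> exists k l,
  [/\ i = rshift 1 k, j = rshift 1 l & x k l != 0].
Proof.
case: (split_ordP i) => k ->; case: (split_ordP j) => l ->;
  rewrite ?block_mxEul ?block_mxEur ?block_mxEdl ?block_mxEdr ?mxE ?eqxx // => xkl.
by exists k, l.
Qed.

Lemma barx_r k : barx (rshift 1 k) = bar k.
Proof. by rewrite /barx (unsplitK (inr k)). Qed.
Lemma htx_r k : htx (rshift 1 k) = - (absi k)%:Z.
Proof. by rewrite /htx (unsplitK (inr k)). Qed.

Lemma homx_ext p x : homogeneous p x -> homx p (ext x).
Proof. by move=> hx i j /ext_nz[k [l [-> -> xkl]]]; rewrite !barx_r; exact: hx. Qed.

Lemma homx1 : homx false 1%:M.
Proof. by move=> i j; rewrite mxE; case: (eqVneq i j) => [->|_]; rewrite ?addbb ?eqxx. Qed.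

Lemma homxM p q x y : homx p x -> homx q y -> homx (p (+) q) (x *m y).
Proof.
move=> hx hy i j; rewrite mxE => nz.
have [k] : exists k, x i k * y k j != 0.
  apply/existsP; apply: contraR nz => /existsPn z.
  by rewrite big1 // => k _; apply/eqP; have := z k; rewrite negbK.
rewrite mulf_eq0 negb_or => /andP[/hx <- /hy <-].
by rewrite addbA -(addbA (barx i)) addbb addbF.
Qed.

Section Tens.
Variables (d : nat) (T : trep d).
Local Notation A := (tA T).
Local Notation iota := (tiota T).
Local Notation P := (tP T).
Local Notation rho := (@trho d T).
Local Notation MA := 'M[A]_(1 + (N + N)).

(* The operator a (x) y; the powers of P implement the sign rule. *)
Definition tens (a : A) (y : glx) : MA :=
  \matrix_(i, j) (iota (y i j) * a * P ^+ (barx i (+) barx j)).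

Lemma tensDl a b y : tens (a + b) y = tens a y + tens b y.
Proof. by apply/matrixP => i j; rewrite !mxE mulrDr mulrDl. Qed.

Lemma tensDr a y z : tens a (y + z) = tens a y + tens a z.
Proof. by apply/matrixP => i j; rewrite !mxE rmorphD !mulrDl. Qed.

Lemma tensZ c a y : tens (iota c * a) y = tens a (c *: y).
Proof. by apply/matrixP => i j; rewrite !mxE rmorphM mulrA -tiota_comm. Qed.

Lemma tensZl c a y : (iota c)%:M *m tens a y = tens a (c *: y).
Proof. by rewrite -tensZ mul_scalar_mx; apply/matrixP => i j; rewrite !mxE !mulrA -tiota_comm. Qed.

Lemma tens_sign (b : bool) a y : tens ((-1) ^+ b * a) y = (-1) ^+ b * (tens a y : 'M[A]_((N + N).+1)).
Proof.
rewrite !mulr_sign; case: b => //.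
by apply/matrixP => i j; rewrite !mxE mulrN mulNr.
Qed.

Lemma P_add (b c : bool) : P ^+ b * P ^+ c = P ^+ (b (+) c).
Proof. by case: b; case: c; rewrite ?expr0 ?expr1 ?mulr1 ?mul1r ?tP_sqr. Qed.

(** Koszul sign rule: the power P^p standing between a and b produces the sign when it is moved past
    b. *)
Lemma tensM (p q : bool) a b y z : homx p y -> P * b = (-1) ^+ q * (b * P) ->
  tens a y *m tens b z = tens ((-1) ^+ (p && q) * (a * b)) (y *m z).
Proof.
move=> hy bP; apply/matrixP => i j; rewrite !mxE rmorph_sum !mulr_suml.
apply: eq_bigr => k _; rewrite !mxE rmorphM.
have [->|nz] := eqVneq (y i k) 0; first by rewrite rmorph0 !mul0r.
rewrite -[barx i (+) barx j](addbK (barx k)).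
have -> : barx i (+) barx j (+) barx k (+) barx k = (barx i (+) barx k) (+) (barx k (+) barx j).
  by rewrite -!addbA; congr (_ (+) _); rewrite addbC addbA.
rewrite (hy _ _ nz) -(P_add p).
have -> : iota (y i k) * a * P ^+ p * (iota (z k j) * b * P ^+ (barx k (+) barx j)) =
   iota (y i k) * iota (z k j) * (a * (P ^+ p * b)) * P ^+ (barx k (+) barx j).
  by rewrite !mulrA -[iota (y i k) * a * P ^+ p * iota _]tiota_comm !mulrA tiota_comm -!mulrA.
have -> : P ^+ p * b = (-1) ^+ (p && q) * (b * P ^+ p).
  by case: (p); rewrite ?expr0 ?expr1 ?mul1r ?mulr1.
have -> : a * ((-1) ^+ (p && q) * (b * P ^+ p)) = (-1) ^+ (p && q) * (a * b) * P ^+ p.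
  by rewrite mulrA commr_sign -!mulrA.
by rewrite !mulrA.
Qed.

Lemma P_comm1 : P * 1 = (-1) ^+ false * (1 * P).
Proof. by rewrite expr0 !mul1r mulr1. Qed.

Local Notation A' := 'M[A]_((N + N).+1).

(** The action on a tensor product, through the primitive coproduct. *)
Definition rhox (x : gl) : A' := tens (rho x) 1%:M + tens 1 (ext x).
Definition iotax (c : C) : A' := scalar_mx (iota c).
Lemma tens11 : tens 1 1%:M = 1 :> A'.
Proof.
apply/matrixP => i j; rewrite !mxE mulr1.
by case: (eqVneq i j) => [->|_]; rewrite ?addbb ?rmorph1 ?mul1r ?rmorph0 ?mul0r.
Qed.

Definition iotax_rmorphism : {rmorphism C -> A'} := @scalar_mx A (N + N).+1 \o iota.
Lemma iotax_sign (b : bool) : iotax ((-1) ^+ b) = (-1) ^+ b.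
Proof. exact: (rmorph_sign iotax_rmorphism). Qed.

Definition signx : glx := diag_mx (\row_i (-1) ^+ barx i).
Definition Px : A' := tens P signx.
Definition starx (B : A') : A' := \matrix_(i, j) tstar (B j i).
(** The matrix position (i, j) already raises the height by [htx i - htx j]; the entry has to supply
    the rest. *)
Definition filx (m : int) (B : A') : Prop := forall i j, tfil (m - (htx i - htx j)) (B i j).

Lemma rho0 : rho 0 = 0.
Proof. by have := trho_linear T (-1) 0 0; rewrite scaler0 addr0 rmorphN1 mulN1r addNr. Qed.

Lemma rhoD x y : rho (x + y) = rho x + rho y.
Proof. by have := trho_linear T 1 x y; rewrite scale1r rmorph1 mul1r. Qed.

Lemma rhoZ a x : rho (a *: x) = iota a * rho x.
Proof. by have := trho_linear T a x 0; rewrite !addr0 rho0 addr0. Qed.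

Lemma tens1M p b x z : homx p x -> P * b = b * P -> tens 1 x *m tens b z = tens b (x *m z).
Proof.
move=> hx bP; rewrite (tensM (p := p) (q := false)) ?expr0 ?mul1r //.
by rewrite andbF expr0 !mul1r.
Qed.

Lemma tensM1 q a b z : P * b = (-1) ^+ (q : bool) * (b * P) ->
  tens a 1%:M *m tens b z = tens (a * b) z.
Proof.
by move=> bP; rewrite (tensM (p := false) (q := q)) ?mul1mx ?expr0 ?mul1r //; exact: homx1.
Qed.

Lemma rhox_mul (p q : bool) x y : homogeneous p x -> homogeneous q y ->
  rhox x * rhox y = tens (rho x * rho y) 1%:M + (tens (rho x) (ext y)
    + (-1) ^+ (p && q) * (tens (rho y) (ext x) : A')) + tens 1 (ext (x *m y)).
Proof.
move=> hx hy; rewrite /rhox mulrDl !mulrDr -!mulmxE.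
have yP := trho_P T hy.
rewrite (tensM1 _ _ yP) (tensM1 _ _ P_comm1) (tensM _ _ (homx_ext hx) yP) mulmx1 mulr1 mul1r.
rewrite (tens1M _ (homx_ext hx)) ?mulr1 ?mul1r // ext_mul tens_sign.
by rewrite !addrA.
Qed.

Lemma rhox_linear a x y : rhox (a *: x + y) = iotax a * rhox x + rhox y.
Proof.
rewrite /rhox rhoD rhoZ ext_linear tensDl tensDr tensZ addrACA; congr (_ + _).
by rewrite mulrDr -!mulmxE !tensZl.
Qed.

(** Exchanging x and y permutes the two mixed terms of [rhox_mul] up to the sign, so they cancel in
    the bracket. *)
Lemma rhox_superbracket (p q : bool) x y : homogeneous p x -> homogeneous q y ->
  rhox (superbracket p q x y) = rhox x * rhox y - (-1) ^+ (p && q) * (rhox y * rhox x).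
Proof.
move=> hx hy; rewrite (rhox_mul hx hy) (rhox_mul hy hx).
rewrite /rhox (trho_superbracket T hx hy) /superbracket.
rewrite andbC; set s : A' := (-1) ^+ (q && p).
have sE a y' : s * (tens a y' : A') = tens ((-1) ^+ (q && p) * a) y' by rewrite tens_sign.
have ss a : s * (s * a) = a by rewrite mulrA -expr2 sqrr_sign mul1r.
have extB : ext (x *m y - (-1) ^+ (q && p) *: (y *m x)) =
    ext (x *m y) - (-1) ^+ (q && p) *: ext (y *m x).
  rewrite addrC -scaleNr ext_linear addrC scaleNr //.
rewrite extB.
have tensN a y' : tens (- a) y' = - tens a y'.
  by apply/matrixP => i j; rewrite !mxE mulrN mulNr.
have tensNr a y' : tens a (- y') = - tens a y'.
  by apply/matrixP => i j; rewrite !mxE rmorphN !mulNr.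
rewrite tensDl tensDr tensN tensNr -tensZ -sE rmorph_sign mulr1.
rewrite -[(-1) ^+ _ in X in _ + (_ - X)]mulr1 -sE.
rewrite !mulrDr ss !opprD.
set t := _ + s * _; rewrite [- _ - tens (rho x) _]addrC -opprD -/t.
by rewrite [RHS]addrACA [in RHS](addrACA _ t) subrr addr0.
Qed.

Lemma signxM (p : bool) y : homx p y -> signx *m y = (-1) ^+ p *: (y *m signx).
Proof.
move=> hy; rewrite mul_diag_mx mul_mx_diag; apply/matrixP => i j; rewrite !mxE.
have [->|nz] := eqVneq (y i j) 0; first by rewrite mul0r !mulr0.
by rewrite -(hy _ _ nz) [y i j * _]mulrC mulrA -signr_addb -addbA addbb addbF.
Qed.

Lemma signx_sqr : signx *m signx = 1%:M.
Proof.
apply/matrixP => i j; rewrite mul_diag_mx !mxE.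
by case: eqVneq => [->|_]; rewrite ?mulr0n ?mulr0 // !mulr1n -expr2 sqrr_sign.
Qed.

Lemma homx_sign : homx false signx.
Proof.
by move=> i j; rewrite mxE; case: (eqVneq i j) => [->|_]; rewrite ?addbb ?eqxx.
Qed.

Lemma Px_sqr : Px * Px = 1.
Proof.
rewrite /Px -mulmxE (tensM (p := false) (q := false)) ?expr0 ?mul1r //; last exact: homx_sign.
by rewrite tP_sqr signx_sqr tens11.
Qed.

Lemma Px_rho (p : bool) x : homogeneous p x -> Px * rhox x = (-1) ^+ p * (rhox x * Px).
Proof.
move=> hx; rewrite /rhox mulrDr mulrDl mulrDr /Px -!mulmxE.
rewrite (tensM (p := false) (q := p)); [|exact: homx_sign|exact: trho_P].
rewrite (tensM1 (q := false)) ?expr0 ?mul1r // (trho_P T hx) mulmx1 tens_sign.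
rewrite (tensM (p := false) (q := false)) ?expr0 ?mul1r ?mulr1 //; last exact: homx_sign.
rewrite (tens1M _ (homx_ext hx)) // (signxM (homx_ext hx)) -tensZ rmorph_sign.
by rewrite tens_sign.
Qed.

Lemma tstar0 : tstar (0 : A) = 0.
Proof. by rewrite -(rmorph0 iota) tstar_iota conjC0. Qed.
Lemma starxM (B D : A') : starx (B * D) = starx D * starx B.
Proof.
apply/matrixP => i j; rewrite -!mulmxE !mxE.
rewrite (big_morph _ (@tstarD _ T) tstar0).
by apply: eq_bigr => k _; rewrite tstarM !mxE.
Qed.

Lemma tstar1 : tstar (1 : A) = 1.
Proof. by rewrite -(rmorph1 iota) tstar_iota conjC1. Qed.

Lemma starx_iota c : starx (iotax c) = iotax (c^*).
Proof.
apply/matrixP => i j; rewrite !mxE eq_sym; case: eqVneq => _; rewrite ?mulr1n ?mulr0n.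
  by rewrite tstar_iota.
by rewrite -(rmorph0 iota) tstar_iota conjC0.
Qed.

Lemma tstar_Pn (b : bool) : tstar (P ^+ b) = P ^+ b.
Proof. by case: b; rewrite ?expr1 ?expr0 ?tstar_P ?tstar1. Qed.

Lemma starx_tens a y : P * a = a * P \/ homx false y ->
  starx (tens a y) = tens (tstar a) (map_mx Num.conj y^T).
Proof.
move=> ay; apply/matrixP => i j; rewrite !mxE !tstarM tstar_Pn tstar_iota.
rewrite [barx i (+) _]addbC; set e := P ^+ _.
rewrite -[tstar a * iota _]tiota_comm mulrA -[e * iota _]tiota_comm -!mulrA.
have [->|nz] := eqVneq (y j i) 0; first by rewrite conjC0 rmorph0 !mul0r.
congr (_ * _); case: ay => [aP|hy]; last by rewrite /e (hy _ _ nz) !expr0 mul1r mulr1.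
have aP' : P * tstar a = tstar a * P by rewrite -(tstar_P T) -!tstarM aP.
by rewrite /e; case: (_ (+) _); rewrite ?expr1 ?expr0 ?mulr1 ?mul1r.
Qed.

Lemma starx_P : starx Px = Px.
Proof.
rewrite /Px starx_tens ?tstar_P; last by left.
congr tens; apply/matrixP => i j; rewrite !mxE.
by case: (eqVneq i j) => [->|]; rewrite ?mulr1n ?mulr0n ?rmorph0 // rmorph_sign.
Qed.

Lemma starx_rho x : starx (rhox x) = rhox (map_mx Num.conj x^T).
Proof.
have starxD (B D : A') : starx (B + D) = starx B + starx D.
  by apply/matrixP => i j; rewrite !mxE tstarD.
rewrite /rhox starxD !starx_tens ?trho_star; last 2 first.
- by left; rewrite mulr1 mul1r.
- by right; exact: homx1.
rewrite tstar1 trmx1 map_mx1 /ext tr_block_mx map_block_mx !trmx0 !map_mx0.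
by [].
Qed.

(** A diagonal entry of star(f) f is a sum of such products over a column. This is why [tpos] is
    stated for finite families: the property then passes to matrices. *)
Lemma tposx (I : finType) (f : I -> A') :
  \sum_i starx (f i) * f i = 0 -> forall i, f i = 0.
Proof.
move=> f0 i; apply/matrixP => k j; rewrite mxE.
have : \sum_(p : I * 'I_(N + N).+1) tstar (f p.1 p.2 j) * f p.1 p.2 j = 0.
  rewrite -(pair_bigA _ (fun x y => tstar (f x y j) * f x y j)) /=.
  transitivity ((\sum_i starx (f i) * f i) j j); last by rewrite f0 mxE.
  rewrite summxE.
  by apply: eq_bigr => x _; rewrite -mulmxE mxE; apply: eq_bigr => y _; rewrite mxE.
by move=> /(tpos (t := T))/(_ (i, k)).
Qed.

Lemma filx_rho x : raising x -> filx 1 (rhox x).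
Proof.
move=> hx i j; rewrite mxE; apply: tfilD; rewrite mxE.
  rewrite mxE; case: eqVneq => [->|_]; last by rewrite rmorph0 !mul0r; exact: tfil0.
  by rewrite subrr subr0 rmorph1 mul1r addbb mulr1; exact: tfil_rho.
rewrite mulr1.
have [->|] := eqVneq (ext x i j) 0; first by rewrite rmorph0 mul0r; exact: tfil0.
move=> /ext_nz [k [l [-> -> /hx kl]]]; rewrite !htx_r.
apply: (@tfil_le _ T (0 + 0)); first by lia.
apply: tfilM; first exact: tfil_iota.
case: (_ (+) _); rewrite ?expr0 ?expr1; first exact: tfil_P.
by rewrite -(rmorph1 iota); exact: tfil_iota.
Qed.

Lemma filxM m n (B D : A') : filx m B -> filx n D -> filx (m + n) (B * D).
Proof.
move=> hB hD i j; rewrite -mulmxE mxE.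
elim/big_rec: _ => [|k a _ IH]; first exact: tfil0.
apply: tfilD IH; apply: tfil_le (tfilM (hB i k) (hD k j)).
by lia.
Qed.

Lemma filx_iota c : filx 0 (iotax c).
Proof.
move=> i j; rewrite mxE; case: eqVneq => [->|_]; last exact: tfil0.
by rewrite subrr subr0; exact: tfil_iota.
Qed.

Lemma filx_P : filx 0 Px.
Proof.
move=> i j; rewrite !mxE; case: eqVneq => [->|_]; last first.
  by rewrite rmorph0 !mul0r; exact: tfil0.
rewrite addbb mulr1 subrr subr0 mulr1n -[0]addr0.
by apply: tfilM; [exact: tfil_iota | exact: tfil_P].
Qed.

Lemma filx_top : exists M, forall a, filx M a -> a = 0.
Proof.
(* Heights lie between -N and 0, so the position of an entry accounts for at most N. *)
have [M hM] := tfil_top T; exists (M + N%:Z) => B hB.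
apply/matrixP => i j; rewrite mxE; apply: hM; apply: tfil_le (hB i j).
have hi : (htx i <= 0)%R by rewrite /htx; case: split => // k; lia.
have hj : (- N%:Z <= htx j)%R.
  by rewrite /htx; case: split => [_|k]; last (have := ltn_ord (absi k)); lia.
by lia.
Qed.

(* A linear map that inverts x |-> ext x on q_N and kills the unit matrix. *)
Definition psi1 (M : glx) : U :=
  Uiota (vsproj (queer R N) (drsubmx M)) - M 0 0 *: Uiota (vsproj (queer R N) 1%:M).

Lemma psi1_linear : linear psi1.
Proof.
move=> a y z; have -> : psi1 (a *: y + z) =
    Uiota (a *: vsproj (queer R N) (drsubmx y) + vsproj (queer R N) (drsubmx z))
    - (a *: y + z) 0 0 *: Uiota (vsproj (queer R N) 1%:M).
  rewrite /psi1; have -> : drsubmx (a *: y + z) = a *: drsubmx y + drsubmx z.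
    by apply/matrixP => i j; rewrite !mxE.
  by rewrite -(linearP (vsproj (queer R N))).
rewrite /psi1 UiotaD UiotaZ !mxE scalerDl.
by rewrite opprD addrACA -scalerA -scalerBr.
Qed.
HB.instance Definition _ := GRing.isLinear.Build C glx U *:%R psi1 psi1_linear.

Lemma psi1_1 : psi1 1%:M = 0.
Proof.
rewrite /psi1 (_ : drsubmx 1%:M = 1%:M) ?mxE ?scale1r ?subrr //.
by apply/matrixP => i j; rewrite !mxE (inj_eq (@rshift_inj _ _)).
Qed.

Lemma psi1_ext (x : subvs_of (queer R N)) : psi1 (ext (vsval x)) = Uiota x.
Proof.
rewrite /psi1 /ext block_mxKdr vsvalK.
have -> : block_mx (0 : 'M_1) 0 0 (vsval x) 0 0 = 0.
  have e0 : (0 : 'I_(1 + (N + N))) = lshift (N + N) 0 by apply/val_inj.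
  by rewrite e0 block_mxEul mxE.
by rewrite scale0r subr0.
Qed.

(** Multiplication in U after [tpsi] (x) [psi1]; the power of P undoes the one in [tens]. *)
Definition psix (B : A') : U :=
  \sum_i \sum_j tpsi (B i j * P ^+ (barx i (+) barx j)) * psi1 (delta_mx i j).

Lemma psixD : {morph psix : B D / B + D}.
Proof.
move=> B D; rewrite /psix -big_split; apply: eq_bigr => i _.
rewrite -big_split; apply: eq_bigr => j _.
by rewrite mxE mulrDl tpsiD mulrDl.
Qed.

Lemma psixZ c B : psix (iotax c * B) = c *: psix B.
Proof.
rewrite /psix scaler_sumr; apply: eq_bigr => i _.
rewrite scaler_sumr; apply: eq_bigr => j _.
by rewrite -mulmxE mul_scalar_mx mxE -mulrA tpsiZ scalerAl.
Qed.

Lemma psix_tens a y : psix (tens a y) = tpsi a * psi1 y.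
Proof.
rewrite {2}[y]matrix_sum_delta linear_sum mulr_sumr; apply: eq_bigr => i _.
rewrite linear_sum mulr_sumr; apply: eq_bigr => j _.
rewrite mxE -!mulrA P_add addbb mulr1 tpsiZ linearZ.
by rewrite -scalerAl -scalerAr.
Qed.

Local Notation rw w := (\prod_(p <- w) rho (Fmx R p.1 p.2)).
Local Notation rwx w := (\prod_(p <- w) rhox (Fmx R p.1 p.2)).

Lemma tens_rhox (p q : bool) a y x : homx p y -> homogeneous q x ->
  tens a y * rhox x = (-1) ^+ (p && q) * (tens (a * rho x) y : A')
     + tens a (y *m ext x).
Proof.
move=> hy hx; rewrite /rhox mulrDr -!mulmxE (tensM _ _ hy (trho_P T hx)) mulmx1 tens_sign.
by rewrite (tensM _ _ hy P_comm1) andbF mul1r mulr1.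
Qed.

(** Every letter sent to the last tensor factor shortens the word in the first one below length d,
    where [tpsi] vanishes. Only the term sending all letters to the first factor survives. *)
Lemma psix_tail w0 w (p : bool) y : homx p y -> (size w0 + size w <= d)%N ->
  psix (tens (rw w0) y * rwx w) =
    (-1) ^+ (p && wpar w) *: (tpsi (rw (w0 ++ w)) * psi1 y).
Proof.
elim: w w0 p y => [|x w IH] w0 p y hy sz.
  by rewrite /wpar !big_nil andbF scale1r mulr1 cats0 psix_tens.
rewrite big_cons mulrA (tens_rhox _ hy (@Fmx_homogeneous R N x.1 x.2)).
rewrite mulrDl psixD -mulrA -iotax_sign psixZ.
have -> : rw w0 * rho (Fmx R x.1 x.2) = rw (rcons w0 x) by rewrite big_rcons.
rewrite (IH _ _ _ hy) ?size_rcons ?addSnnS // cat_rcons.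
rewrite (IH _ _ _ (homxM hy (homx_ext (@Fmx_homogeneous R N x.1 x.2)))); last first.
  by move: sz => /=; lia.
rewrite (tpsi_short T (w := w0 ++ w)) ?size_cat; last by move: sz => /=; lia.
by rewrite mul0r scaler0 addr0 scalerA -signr_addb -andb_addr /wpar big_cons.
Qed.

Lemma psix_short w0 w : (size w0 + size w < d.+1)%N ->
  psix (tens (rw w0) 1%:M * rwx w) = 0.
Proof.
move=> sz; rewrite (psix_tail homx1) //.
by rewrite psi1_1 mulr0 scaler0.
Qed.

Lemma UfiltB e u v : Ufilt e u -> Ufilt e v -> Ufilt e (u - v).
Proof. by move=> hu hv; rewrite -scaleN1r; apply/Ufilt_D/Ufilt_Z. Qed.

(** Since [psi1] kills the unit matrix and [tpsi] the short words, exactly one letter of w goes to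
    the last factor. Each of the [size w] choices gives d! times a reordering of the word, equal to
    it up to sign and lower terms. For empty w0 the total is (d+1) d!. *)
Lemma psix_top w0 w : (size w0 + size w = d.+1)%N ->
  Ufilt d.+1 (psix (tens (rw w0) 1%:M * rwx w)
     - (size w * d`!)%:R *: Fword F (w0 ++ w)).
Proof.
elim: w w0 => [|[i j] w IH] w0 sz.
  rewrite big_nil mulr1 psix_tens psi1_1 mulr0 mul0n scale0r subrr; exact: Ufilt_0.
have szw : (size w0 + size w = d)%N by move: sz => /=; lia.
have hx := @Fmx_homogeneous R N i j.
rewrite big_cons mulrA (tens_rhox _ homx1 hx) mul1r mulrDl psixD mul1mx.
have -> : rw w0 * rho (Fmx R i j) = rw (rcons w0 (i, j)) by rewrite big_rcons.
rewrite (psix_tail (homx_ext hx)) ?szw // (psi1_ext (Fq R i j)).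
rewrite -[Uiota _]/(Fgen R i j) -cat_rcons.
have := IH (rcons w0 (i, j)); rewrite size_rcons addSn szw => /(_ erefl) h1.
set s := (-1) ^+ (par i j && wpar w) : C.
have h2 : Ufilt d.+1 (s *: (tpsi (rw (w0 ++ w)) * F i j)
    - d`!%:R *: Fword F (rcons w0 (i, j) ++ w)).
  have := tpsi_top T (w := w0 ++ w); rewrite size_cat szw => /(_ erefl) h3.
  have h4 := Ufilt_wordr [:: (i, j)] h3; rewrite addn1 Fword1 in h4.
  have h5 := Ufilt_wordl w0 (Fword_move (@Fgen_sbr R N) i j w).
  rewrite addnS szw in h5.
  (* The sign s left by [psix_tail] is the one that moves F_ij back to its place in front of w. *)
  have := UfiltB (Ufilt_Z s h4) (Ufilt_Z d`!%:R h5).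
  move: (tpsi _) => t; congr Ufilt; rewrite cat_rcons !Fword_cat.
  have -> : Fword F ((i, j) :: w) = F i j * Fword F w by rewrite /Fword big_cons.
  rewrite mulrBl mulrBr -scalerAl -scalerAr !scalerBr -/s !scalerA mulrA mulrA.
  by rewrite [d`!%:R * s]mulrC opprB addrA subrK.
have := Ufilt_D h1 h2; congr Ufilt.
by rewrite addrACA -opprD -scalerDl -natrD [(_ + d`!)%N]addnC -mulSn.
Qed.

Definition trep_step : trep d.+1.
Proof.
refine (@TRep d.+1 A' iotax_rmorphism _ Px Px_sqr starx _ starxM _ starx_iota starx_P tposx
  rhox rhox_linear (@Px_rho) rhox_superbracket starx_rho filx _ _ filxM _ filx_iota
  filx_P filx_rho filx_top psix psixD psixZ _ _).
- move=> c B; rewrite -[iotax_rmorphism c]/(scalar_mx (iota c)) -diag_const_mx.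
  rewrite -!mulmxE mul_diag_mx mul_mx_diag.
  by apply/matrixP => i j; rewrite !mxE tiota_comm.
- by move=> B D; apply/matrixP => i j; rewrite !mxE tstarD.
- by move=> B; apply/matrixP => i j; rewrite !mxE tstarK.
- by move=> m i j; rewrite mxE; exact: tfil0.
- by move=> m B D hB hD i j; rewrite mxE; exact: tfilD.
- move=> m n B nm hB i j; apply: tfil_le (hB i j); lia.
- move=> w sz; have := @psix_short [::] w; rewrite add0n => /(_ sz).
  by rewrite big_nil (_ : tens 1 1%:M = 1) ?mul1r //; exact: tens11.
- move=> w sz; have := @psix_top [::] w; rewrite add0n => /(_ sz).
  by rewrite big_nil tens11 mul1r /= sz -factS.
Defined.

End Tens.
Lemma trep_exists d : trep d.
Proof. by elim: d => [|d]; [exact: trep0 | exact: trep_step]. Qed.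

End TensorRep.

(** * Injectivity of the Harish-Chandra map on the centre *)

Section Injectivity.
Variables (R : realType) (N : nat).
Local Notation C := R[i].
Local Notation U := (Uq R N).
Local Notation F := (@Fgen R N).
Local Notation Ufilt := (@Ufilt C U N F).
Local Notation HCker := (@HCker C U N F).

Implicit Types i j : 'I_(N + N).

Lemma Fmx_adjoint i j : map_mx Num.conj (Fmx R i j)^T = Fmx R j i.
Proof.
apply/matrixP => k l; rewrite !mxE rmorphD !rmorph_nat.
by rewrite andbC [in X in _ + X = _]andbC.
Qed.

Lemma Fmx_raising i j : (absi i < absi j)%N -> raising (Fmx R i j).
Proof.
move=> ij k l; rewrite !mxE; case: andP => [[/eqP-> /eqP->]|_] //.
rewrite add0r; case: andP => [[/eqP-> /eqP->]|_]; last by rewrite eqxx.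
by rewrite !absi_opp.
Qed.

Section OneRep.
Variables (d : nat) (T : trep R N d).
Local Notation A := (tA T).
Local Notation P := (tP T).
Local Notation star := (@tstar _ _ _ T).

Definition rhoT : U -> A := rhoU (tiota T) (@trho _ _ _ T).

Lemma rhoTD : {morph rhoT : u v / u + v}.
Proof.
exact: (rhoUD (tiota_comm (t := T)) (trho_linear T) (trho_superbracket T)).
Qed.

Lemma rhoTM : {morph rhoT : u v / u * v}.
Proof.
exact: (rhoUM (tiota_comm (t := T)) (trho_linear T) (trho_superbracket T)).
Qed.

Lemma rhoTZ a u : rhoT (a *: u) = tiota T a * rhoT u.
Proof.
exact: (rhoUZ (tiota_comm (t := T)) (trho_linear T) (trho_superbracket T)).
Qed.

Lemma rhoT1 : rhoT 1 = 1.
Proof.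
exact: (rhoU1 (tiota_comm (t := T)) (trho_linear T) (trho_superbracket T)).
Qed.

Lemma rhoT_iota x : rhoT (Uiota x) = trho T (vsval x).
Proof.
exact: (rhoU_iota (tiota_comm (t := T)) (trho_linear T) (trho_superbracket T)).
Qed.

Lemma rhoT0 : rhoT 0 = 0.
Proof. by rewrite -(scale0r 0) rhoTZ rmorph0 mul0r. Qed.

Lemma rhoT_F i j : rhoT (F i j) = trho T (Fmx R i j).
Proof. exact: rhoT_iota. Qed.

Lemma star_F i j : star (rhoT (F i j)) = rhoT (F j i).
Proof. by rewrite !rhoT_F trho_star Fmx_adjoint. Qed.

Lemma rhoT_P p u : Uhomogeneous p u -> P * rhoT u = (-1) ^+ p * (rhoT u * P).
Proof.
elim=> {p u} [p x hx||p q u v _ IHu _ IHv|p|p u v _ IHu _ IHv|p a u _ IH].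
- by rewrite rhoT_iota; exact: trho_P.
- by rewrite rhoT1 mulr1 !mul1r.
- rewrite rhoTM mulrA IHu -!mulrA IHv signr_addb -!mulrA; congr (_ * _).
  by rewrite [LHS]mulrA commr_sign -[LHS]mulrA.
- by rewrite rhoT0 mulr0 mul0r mulr0.
- by rewrite rhoTD mulrDr mulrDl mulrDr IHu IHv.
- rewrite rhoTZ mulrA -tiota_comm -!mulrA IH.
  by rewrite [LHS]mulrA commr_sign -[LHS]mulrA.
Qed.

(** Here an element of A stands for a vector, or rather for an operator whose image consists of
    singular vectors. *)
Definition singular (a : A) := forall i j, (absi i < absi j)%N -> rhoT (F i j) * a = 0.

(* Since n_- is adjoint to n_+, the image of n_- is orthogonal to singular
   vectors. *)
Lemma singular_HCker v a c : HCker v -> singular a -> singular c ->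
  star c * (rhoT v * a) = 0.
Proof.
move=> hv ha hc; elim: hv => {v} [|u v _ IHu _ IHv|i j u ij|u i j ij].
- by rewrite rhoT0 mul0r mulr0.
- by rewrite rhoTD mulrDl mulrDr IHu IHv addr0.
- rewrite rhoTM -!mulrA mulrA -star_F -tstarM hc //.
  by rewrite tstar0 mul0r.
- by rewrite rhoTM -mulrA ha // !mulr0.
Qed.

Lemma positive_definite (a : A) : star a * a = 0 -> a = 0.
Proof.
move=> aa; have := @tpos _ _ _ T 'I_1 (fun=> a); rewrite big_ord1.
by move=> /(_ aa ord0).
Qed.

Lemma double_eq0 (a : A) : a + a = 0 -> a = 0.
Proof.
move=> aa; rewrite -[a]mul1r -(rmorph1 (tiota T)) -[1](@mulVf C 2%:R) ?pnatr_eq0 //.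
have -> : tiota T (2%:R^-1 * 2%:R) * a = tiota T 2%:R^-1 * (a + a).
  by rewrite rmorphM rmorph_nat -mulrA mulr_natl mulr2n.
by rewrite aa mulr0.
Qed.

Section Central.
Variables z0 z1 : U.
Hypothesis z0_even : Uhomogeneous false z0.
Hypothesis z1_odd : Uhomogeneous true z1.
Hypothesis z0C : forall i j, z0 * F i j = F i j * z0.
Hypothesis z1C : forall i j, z1 * F i j = (-1) ^+ par i j *: (F i j * z1).
Hypothesis zker : HCker (z0 + z1).

Let rz0C i j : rhoT (F i j) * rhoT z0 = rhoT z0 * rhoT (F i j).
Proof. by rewrite -!rhoTM z0C. Qed.

Let rz1C i j : rhoT (F i j) * rhoT z1 = (-1) ^+ par i j * (rhoT z1 * rhoT (F i j)).
Proof.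
by rewrite -!rhoTM z1C rhoTZ rmorph_sign mulrA -expr2 sqrr_sign mul1r.
Qed.

Lemma central_kills_singular_sum a : singular a -> rhoT z0 * a + rhoT z1 * a = 0.
Proof.
move=> ha; rewrite -mulrDl -rhoTD; apply: positive_definite.
apply: singular_HCker => // i j ij; rewrite rhoTD mulrDl mulrDr !mulrA rz0C rz1C.
by rewrite -!mulrA ha // !mulr0 addr0.
Qed.

Lemma singular_P a : singular a -> singular (P * a).
Proof.
move=> ha i j ij; have := rhoT_P (Uhomogeneous_Fgen R i j) => e.
have {}e : rhoT (F i j) * P = (-1) ^+ par i j * (P * rhoT (F i j)).
  by rewrite e mulrA -expr2 sqrr_sign mul1r.
by rewrite mulrA e -!mulrA ha // !mulr0.
Qed.

(** P a is singular too, and P commutes with z0 and anticommutes with z1. So z0 a - z1 a vanishes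
    along with z0 a + z1 a. *)
Lemma central_kills_singular a : singular a -> rhoT z0 * a = 0 /\ rhoT z1 * a = 0.
Proof.
move=> ha; have e1 := central_kills_singular_sum ha.
have e2 : rhoT z0 * a - rhoT z1 * a = 0.
  have := central_kills_singular_sum (singular_P ha).
  have h0 := rhoT_P z0_even; have h1 := rhoT_P z1_odd.
  rewrite expr0 mul1r in h0; rewrite expr1 mulN1r in h1.
  rewrite !mulrA -h0 -[rhoT z1 * P]opprK -h1 mulNr -!mulrA -mulrBr => e.
  by rewrite -[LHS]mul1r -(tP_sqr T) -mulrA e mulr0.
have z0a : rhoT z0 * a = 0.
  by apply: double_eq0; rewrite -[RHS]addr0 -{1}e1 -e2 addrACA addrN addr0.
by split=> //; rewrite z0a add0r in e1.
Qed.

(** The right ideal generated by both adjoints, so that one argument covers z0 and z1. *)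
Definition in_image (y : A) := exists b0 b1, y = star (rhoT z0) * b0 + star (rhoT z1) * b1.

Lemma in_image_F y i j : in_image y -> in_image (rhoT (F i j) * y).
Proof.
move=> [b0 [b1 ->]].
have h0 : rhoT (F i j) * star (rhoT z0) = star (rhoT z0) * rhoT (F i j).
  by rewrite -(star_F j i) -!tstarM rz0C.
have h1 : rhoT (F i j) * star (rhoT z1) =
    star (rhoT z1) * ((-1) ^+ par i j * rhoT (F i j)).
  have sgn : star ((-1) ^+ par i j) = (-1) ^+ par i j.
    by rewrite -(rmorph_sign (tiota T)) tstar_iota !rmorph_sign.
  rewrite -(star_F j i) -{1}sgn -!tstarM commr_sign -mulrA rz1C [par j i]addbC.
  by rewrite mulrA -expr2 sqrr_sign mul1r.
exists (rhoT (F i j) * b0), ((-1) ^+ par i j * rhoT (F i j) * b1).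
by rewrite mulrDr !mulrA h0 h1 !mulrA.
Qed.

(* z0 and z1 kill the singular vectors, which are thus orthogonal to the image
   of the adjoints of z0 and z1. *)
Lemma in_image_singular y : in_image y -> singular y -> y = 0.
Proof.
move=> [b0 [b1 yE]] /central_kills_singular[y0 y1]; apply: positive_definite.
rewrite {1}yE tstarD !tstarM !tstarK mulrDl -!mulrA y0 y1.
by rewrite !mulr0 addr0.
Qed.

(** If raising words of length k + 1 kill y, those of length k kill each F_ij y with |i| < |j|. By
    induction these are 0, so y is singular. *)
Lemma in_image_nilpotent k y : in_image y ->
  (forall w : seq ('I_(N + N) * 'I_(N + N)), size w = k ->
     all (fun p => absi p.1 < absi p.2)%N w -> rhoT (Fword F w) * y = 0) -> y = 0.
Proof.
elim: k y => [|k IH] y hy hw.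
  by have := hw [::] erefl erefl; rewrite /Fword big_nil rhoT1 mul1r.
apply: in_image_singular => // i j ij; apply: IH; first exact: in_image_F.
move=> w wk aw; rewrite mulrA -rhoTM.
have -> : Fword F w * F i j = Fword F (rcons w (i, j)) by rewrite /Fword big_rcons.
by apply: hw; rewrite ?size_rcons ?wk // all_rcons /= ij.
Qed.

Lemma raising_word_fil (w : seq ('I_(N + N) * 'I_(N + N))) :
  all (fun p => absi p.1 < absi p.2)%N w -> tfil (size w)%:Z (rhoT (Fword F w)).
Proof.
elim: w => [_|[i j] w IH /= /andP[ij aw]].
  by rewrite /Fword big_nil rhoT1 -(rmorph1 (tiota T)); exact: tfil_iota.
have -> : Fword F ((i, j) :: w) = F i j * Fword F w by rewrite /Fword big_cons.
rewrite rhoTM -add1n PoszD; apply: tfilM (IH aw).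
by rewrite rhoT_F; exact/tfil_rho/Fmx_raising.
Qed.

Lemma in_image_eq0 y : in_image y -> y = 0.
Proof.
have [M hM] := tfil_top T => hy.
apply: (in_image_nilpotent (k := `|M|%N)) hy _ => w wM aw.
rewrite (hM (rhoT (Fword F w))) ?mul0r //.
by apply: tfil_le (raising_word_fil aw); rewrite wM; lia.
Qed.

Lemma central_rep_eq0 : rhoT (z0 + z1) = 0.
Proof.
have star_eq0 a : star a = 0 -> a = 0 by move=> e; rewrite -(tstarK (t := T) a) e tstar0.
have e0 : rhoT z0 = 0.
  by apply/star_eq0/in_image_eq0; exists 1, 0; rewrite mulr0 mulr1 addr0.
have e1 : rhoT z1 = 0.
  by apply/star_eq0/in_image_eq0; exists 0, 1; rewrite mulr0 mulr1 add0r.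
by rewrite rhoTD e0 e1 addr0.
Qed.

End Central.

Lemma rhoT_Fword w : rhoT (Fword F w) = \prod_(p <- w) trho T (Fmx R p.1 p.2).
Proof.
elim: w => [|p w IH]; first by rewrite /Fword !big_nil rhoT1.
by rewrite /Fword !big_cons rhoTM rhoT_F -IH.
Qed.

Lemma symbol_psi u : Ufilt d.+1 u -> Ufilt d (tpsi (rhoT u) - d`!%:R *: u).
Proof.
have psi0 : @tpsi _ _ _ T 0 = 0 by rewrite -(mulr0 (tiota T 0)) tpsiZ scale0r.
elim=> {u} [w|| u v _ IHu _ IHv|a u _ IH].
- rewrite ltnS leq_eqVlt => /orP[/eqP wd|wd]; rewrite rhoT_Fword.
    exact: tpsi_top.
  by rewrite tpsi_short // sub0r -scaleNr; apply/Ufilt_Z/Ufilt_word.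
- rewrite rhoT0 psi0 scaler0 subrr; exact: Ufilt_0.
- by rewrite rhoTD tpsiD scalerDr opprD addrACA; exact: Ufilt_D.
- rewrite rhoTZ tpsiZ scalerA mulrC -scalerA -scalerBr; exact: Ufilt_Z.
Qed.

Lemma Ufilt_rep_eq0 u : Ufilt d.+1 u -> rhoT u = 0 -> Ufilt d u.
Proof.
move=> /symbol_psi; have psi0 : @tpsi _ _ _ T 0 = 0.
  by rewrite -(mulr0 (tiota T 0)) tpsiZ scale0r.
move=> hu u0; move: hu; rewrite u0 psi0 sub0r -scaleNr => hu.
have := Ufilt_Z (- d`!%:R)^-1 hu; rewrite scalerA mulVf ?scale1r //.
by rewrite oppr_eq0 pnatr_eq0 -lt0n fact_gt0.
Qed.

End OneRep.

Lemma Uq_jointly_faithful (u : U) :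
  (forall d (T : trep R N d), rhoT T u = 0) -> u = 0.
Proof.
move=> hu; have [e he] := Ufilt_exhaust u.
(* Vanishing on the e-th tensor power lowers the filtration from e + 1 to e. *)
have {he} : Ufilt 0 u.
  elim: e he => // e IH he; apply: IH.
  exact: Ufilt_rep_eq0 he (hu _ (trep_exists R N e)).
elim=> {hu u} [w||u v _ -> _ ->|a u _ ->] //; first by rewrite addr0.
by rewrite scaler0.
Qed.

Theorem HC_injective (z : U) : in_center z -> nminusU_Unplus z -> z = 0.
Proof.
move=> [z0 [z1 [-> h0 h1 zc]]] /nminusU_UnplusP hz; apply: Uq_jointly_faithful => d T.
apply: central_rep_eq0 => // i j; have [e0 e1] := zc _ _ (Uhomogeneous_Fgen R i j).
  exact: e0.
exact: e1.
Qed.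

End Injectivity.

(** * Stirling numbers and generating series *)

Section StirlingCount.
Variables n m : nat.

Section Block.
Variable P : {set {set 'I_n}}.
Hypothesis Ppart : partition P [set: 'I_n].

Let pblock_in x : pblock P x \in P.
Proof. by apply: pblock_mem; rewrite (cover_partition Ppart) in_setT. Qed.

Definition block_of x : {B | B \in P} := exist _ (pblock P x) (pblock_in x).

Definition block_fun (g : {ffun {B | B \in P} -> 'I_m}) : {ffun 'I_n -> 'I_m} :=
  [ffun x => g (block_of x)].

Lemma block_of_surj B : exists x, block_of x = B.
Proof.
case: B => B BP; have /and3P[_ tP nP] := Ppart.
have /set0Pn[x xB] : B != set0 by apply: contraNneq nP => <-.
by exists x; apply/val_inj/def_pblock.
Qed.

Lemma block_fun_inj : injective block_fun.
Proof.
move=> g h gh; apply/ffunP => B; have [x <-] := block_of_surj B.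
by have := congr1 (fun f : {ffun _ -> _} => f x) gh; rewrite !ffunE.
Qed.

(** The maps with kernel P are those that factor through the set of blocks by an injection. *)
Lemma block_fun_image :
  block_fun @: [set g : {ffun {B | B \in P} -> 'I_m} | injectiveb g] =
    [set f : {ffun 'I_n -> 'I_m} | preim_partition f [set: 'I_n] == P].
Proof.
have /and3P[_ tP nP] := Ppart.
have same x y : (y \in pblock P x) = (block_of x == block_of y).
  rewrite -val_eqE /= eq_pblock // (cover_partition Ppart) in_setT //.
apply/setP => f; rewrite !inE; apply/imsetP/eqP => [[g]|fP].
  rewrite inE => /injectiveP ginj ->; rewrite -[RHS](equivalence_partition_pblock Ppart).
  apply: eq_imset => x; apply/setP => y; rewrite !inE /= !ffunE.
  by rewrite (inj_eq ginj) same.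
have fker x y : (f x == f y) = (block_of x == block_of y).
  rewrite -same -fP pblock_equivalence_partition ?in_setT //.
  by move=> ? ? ? _ _ _; split=> // /eqP->.
have [h hK] := choice block_of_surj.
exists [ffun B => f (h B)]; last first.
  by apply/ffunP => x; rewrite !ffunE; apply/eqP; rewrite fker hK.
rewrite inE; apply/injectiveP => B B'; rewrite !ffunE => /eqP.
by rewrite fker !hK => /eqP.
Qed.

Lemma card_fun_kernel :
  #|[set f : {ffun 'I_n -> 'I_m} | preim_partition f [set: 'I_n] == P]| = m ^_ #|P|.
Proof.
rewrite -block_fun_image (card_imset _ block_fun_inj) card_inj_ffuns card_ord.
by rewrite card_sig.
Qed.

End Block.

(* Both sides count the maps from 'I_n to 'I_m, sorted by their kernel. *)
Lemma expn_stirling2 : (m ^ n = \sum_(k < n.+1) stirling2 n k * m ^_ k)%N.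
Proof.
have -> : (m ^ n = #|{: {ffun 'I_n -> 'I_m}}|)%N by rewrite card_ffun !card_ord.
pose part := [set P : {set {set 'I_n}} | partition P [set: 'I_n]].
rewrite -sum1_card (partition_big (fun f : {ffun 'I_n -> 'I_m} => preim_partition f setT)
  (mem part)) /=; last by move=> f _; rewrite inE; exact: preim_partitionP.
transitivity (\sum_(P in part) m ^_ #|P|)%N.
  apply: eq_bigr => P; rewrite inE => hP; rewrite -(card_fun_kernel hP) sum1dep_card.
  by apply: eq_card => f; rewrite !inE.
have cardP (P : {set {set 'I_n}}) : P \in part -> (#|P| < n.+1)%N.
  rewrite inE => hP; rewrite ltnS.
  rewrite -[X in (_ <= X)%N](card_ord n) -cardsT -(card_transversal (transversalP hP)).
  exact: subset_leq_card (subsetT _).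
rewrite (partition_big (fun P : {set {set 'I_n}} => inord #|P| : 'I_n.+1) predT) //=.
apply: eq_bigr => k _; rewrite -sum_nat_const; apply: eq_big => [P|P /andP[hP /eqP <-]].
  rewrite !inE; case hP: (partition _ _) => //=.
  by rewrite -val_eqE /= inordK // cardP // inE.
by rewrite inordK // cardP.
Qed.

End StirlingCount.

(** * Powers in terms of falling factorials *)

Section StirlingPoly.

Lemma falling_natr (m k : nat) : falling (m%:R : int) k = (m ^_ k)%:R.
Proof.
rewrite /falling ffact_prod; have [lekm|ltmk] := leqP k m.
  rewrite natr_prod; apply: eq_bigr => i _; rewrite natrB //.
  exact: leq_trans (ltnW (ltn_ord i)) lekm.
rewrite (bigD1 (Ordinal ltmk)) //= subrr mul0r.
by rewrite (bigD1 (Ordinal ltmk)) //= subnn mul0n.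
Qed.

Lemma falling_morph (A B : pzRingType) (f : {rmorphism A -> B}) x k :
  f (falling x k) = falling (f x) k.
Proof.
rewrite /falling rmorph_prod; apply: eq_bigr => i _.
by rewrite rmorphB rmorph_nat.
Qed.

Lemma falling_recr (A : pzRingType) (x : A) k : falling x k.+1 = falling x k * (x - k%:R).
Proof. by rewrite /falling big_ord_recr. Qed.

Lemma falling_recl (A : pzRingType) (x : A) k : falling x k.+1 = x * falling (x - 1) k.
Proof.
rewrite /falling big_ord_recl subr0; congr (_ * _); apply: eq_bigr => i _.
by rewrite /bump /= natrD opprD addrA.
Qed.

Lemma expr_stirling2_int n :
  'X^n = \sum_(k < n.+1) falling ('X : {poly int}) k *+ stirling2 n k.
Proof.
apply/eqP; rewrite -subr_eq0; apply/eqP; set p := _ - _.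
(* Every natural number is a root by the counting identity; as many are taken as the size of p. *)
pose rs := [seq (m%:R : int) | m <- iota 0 (size p)].
apply: (@roots_geq_poly_eq0 _ p rs); last by rewrite size_map size_iota.
  apply/allP => _ /mapP[m _ ->]; rewrite /root /p hornerD hornerN hornerXn horner_sum.
  rewrite -natrX expn_stirling2 natr_sum subr_eq0; apply/eqP; apply: eq_bigr => k _.
  rewrite hornerMn -[(falling _ _).[_]]/(horner_eval m%:R _) falling_morph.
  by rewrite /= /horner_eval hornerX falling_natr natrM mulr_natl.
rewrite map_inj_uniq ?iota_uniq // => a b /eqP.
by rewrite eqr_nat => /eqP.
Qed.

Lemma expr_stirling2 (A : comNzRingType) (x : A) n :
  x ^+ n = \sum_(k < n.+1) falling x k *+ stirling2 n k.
Proof.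
pose ev := horner_morph (fun a : int => commr_int x a).
have evX : ev 'X = x by exact: horner_morphX.
rewrite -{1}evX -rmorphXn /= expr_stirling2_int rmorph_sum /=.
by apply: eq_bigr => k _; rewrite rmorphMn falling_morph /= -/ev evX.
Qed.

(** Termwise, x (x-1 down k) = (x down k) (x - k) gives k (x down k) = x ((x down k) - (x-1 down
    k)). *)
Lemma weighted_stirling2 (A : comNzRingType) (x : A) n :
  \sum_(k < n.+1) falling x k *+ (k * stirling2 n k) = x * (x ^+ n - (x - 1) ^+ n).
Proof.
rewrite (expr_stirling2 x) (expr_stirling2 (x - 1)) -sumrB mulr_sumr.
apply: eq_bigr => k _; rewrite mulrnA -mulrnBl mulrnAr; congr (_ *+ _).
rewrite mulrBr -falling_recl falling_recr mulrBr [x * _]mulrC opprB addrC addrNK.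
by rewrite mulr_natr.
Qed.

End StirlingPoly.

(** * Power series in a nilpotent variable *)

Section TruncatedSeries.
Variables (K : fieldType) (A : comAlgType K) (t : A) (M : nat).
Hypothesis tM : t ^+ M.+1 = 0.
Implicit Types f g : nat -> K.

Definition tser f : A := \sum_(k < M.+1) f k *: t ^+ k.

Lemma eq_tser f g : (forall k, f k = g k) -> tser f = tser g.
Proof. by move=> fg; apply: eq_bigr => k _; rewrite fg. Qed.

Lemma tserD f g : tser (fun k => f k + g k) = tser f + tser g.
Proof. by rewrite -big_split; apply: eq_bigr => k _; rewrite scalerDl. Qed.

Lemma tserB f g : tser (fun k => f k - g k) = tser f - tser g.
Proof. by rewrite -sumrB; apply: eq_bigr => k _; rewrite scalerBl. Qed.

Lemma tserZ a f : tser (fun k => a * f k) = a *: tser f.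
Proof. by rewrite scaler_sumr; apply: eq_bigr => k _; rewrite scalerA. Qed.

Lemma tser_sum I r (P : pred I) (F : I -> nat -> K) :
  tser (fun k => \sum_(i <- r | P i) F i k) = \sum_(i <- r | P i) tser (F i).
Proof. by rewrite exchange_big; apply: eq_bigr => k _; rewrite scaler_suml. Qed.

Lemma tser1 : tser (fun k => (k == 0)%:R) = 1.
Proof.
rewrite /tser big_ord_recl expr0 scale1r big1 ?addr0 // => k _.
by rewrite scale0r.
Qed.

Lemma tser_shift f : t * tser f = tser (fun k => if k is k'.+1 then f k' else 0).
Proof.
rewrite /tser mulr_sumr big_ord_recr [RHS]big_ord_recl /= scale0r add0r.
rewrite -scalerAr -exprS tM scaler0 addr0; apply: eq_bigr => k _.
by rewrite -scalerAr -exprS.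
Qed.

Lemma tser_shiftn j f :
  t ^+ j * tser f = tser (fun k => if (j <= k)%N then f (k - j)%N else 0).
Proof.
elim: j f => [|j IH] f.
  by rewrite mul1r; apply: eq_tser => k; rewrite subn0.
rewrite exprSr -mulrA tser_shift IH; apply: eq_tser => k.
case: (ltngtP j k) => [jk|//|->]; last by rewrite subnn.
by rewrite -[(k - j)%N]prednK ?subn_gt0 // -subnS.
Qed.

Lemma tserM f g : tser f * tser g =
  tser (fun k => \sum_(j < M.+1) if (j <= k)%N then g j * f (k - j)%N else 0).
Proof.
rewrite tser_sum {2}/tser mulr_sumr; apply: eq_bigr => j _.
rewrite -scalerAr mulrC tser_shiftn -tserZ; apply: eq_tser => k.
by case: ifP; rewrite ?mulr0.
Qed.

(** The inverse of 1 - y t. *)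
Definition geo y := tser (fun k => y ^+ k).

Lemma geoP y : (1 - y *: t) * geo y = 1.
Proof.
rewrite mulrBl mul1r -scalerAl /geo tser_shift -tserZ -tserB -tser1.
by apply: eq_tser => -[|k]; rewrite ?mulr0 ?subr0 //= exprS subrr.
Qed.

Lemma geoN1 : (1 + t) * geo (-1) = 1.
Proof. by have := geoP (-1); rewrite scaleN1r opprK. Qed.

(* With t = 1/w this is 1/(w(w+1)). *)
Definition tau : A := t ^+ 2 * geo (-1).

Lemma tauP : (1 + t) * tau = t ^+ 2.
Proof. by rewrite /tau mulrCA geoN1 mulr1. Qed.

(** Negative binomial series for (1 + t)^-(r+1), by Pascal's rule. *)
Lemma geo_pow r : geo (-1) ^+ r.+1 = tser (fun s => (-1) ^+ s * 'C(r + s, r)%:R).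
Proof.
elim: r => [|r IH].
  by rewrite expr1; apply: eq_tser => s; rewrite bin0 mulr1.
rewrite exprS IH; have h : tser (fun s => (-1) ^+ s * 'C(r + s, r)%:R) =
    (1 + t) * tser (fun s => (-1) ^+ s * 'C(r.+1 + s, r.+1)%:R).
  rewrite mulrDl mul1r tser_shift -tserD; apply: eq_tser => -[|s].
    by rewrite !addn0 !binn addr0.
  by rewrite (addSnnS r s) (addSn r s.+1) binS natrD exprS; ring.
by rewrite h mulrA [geo _ * _]mulrC geoN1 mul1r.
Qed.

(** Origin of the binomial coefficients and of the sign (-1)^m in the theorem: they expand T^-(r+1)
    in powers of 1/w. *)
Lemma tau_pow r : tau ^+ r.+1 =
  tser (fun m => if (r.+1.*2 <= m)%N then (-1) ^+ m * 'C(m - r.+1 - 1, r)%:R else 0).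
Proof.
rewrite /tau exprMn -exprM geo_pow tser_shiftn mul2n; apply: eq_tser => m.
case: ifP => // rm; congr (_ * 'C(_, _)%:R); last by lia.
by rewrite -{2}(subnK rm) exprD -mul2n exprM sqrrN !expr1n mulr1.
Qed.

Lemma tau_nilpotent s : (M <= s)%N -> tau ^+ s.+1 = 0.
Proof.
move=> Ms; rewrite exprMn -exprM.
have -> : (2 * s.+1 = M.+1 + (2 * s.+1 - M.+1))%N by lia.
by rewrite exprD tM !mul0r.
Qed.

End TruncatedSeries.

(** * Partial fractions and the product formula *)

Section PartialFractions.
Variables (K : fieldType) (N : nat) (x : 'I_N -> K).
Hypothesis x_inj : injective x.
Hypothesis x_neq0 : forall i, x i != 0.

(* The residue at w = x_i of B(w) = prod_i (w + x_i) / (w - x_i) is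
   2 * qres i * x i. *)
Definition qres i := \prod_(j < N | j != i) ((x i + x j) / (x i - x j)).

(** Both sides have degree at most N and agree at the N + 1 points 0 and 1/x_i. *)
Lemma qres_partial_fractions :
  \prod_i (1 + x i *: 'X) =
  \prod_i (1 - x i *: 'X) +
    \sum_i (2 * qres i * x i) *: ('X * \prod_(j < N | j != i) (1 - x j *: 'X)) :> {poly K}.
Proof.
have size_lin a : (size (1 + a *: 'X : {poly K})%R <= 2)%N.
  rewrite (leq_trans (size_polyD _ _)) // geq_max size_poly1 /=.
  by rewrite (leq_trans (size_scale_leq _ _)) // size_polyX.
have size_prod (P : pred 'I_N) (f : 'I_N -> K) :
    (size (\prod_(j | P j) (1 + f j *: 'X : {poly K}))%R <= #|P|.+1)%N.
  apply: leq_trans (size_poly_prod_leq _ _) _.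
  have : (\sum_(j | P j) size (1 + f j *: 'X : {poly K})%R <= \sum_(j | P j) 2)%N.
    by apply: leq_sum => j _; exact: size_lin.
  by rewrite sum_nat_const; move: (\sum_(j | P j) _)%N #|P| => s c; lia.
have linN j : 1 - x j *: 'X = 1 + (- x j) *: 'X :> {poly K} by rewrite scaleNr.
apply/eqP; rewrite -subr_eq0; apply/eqP; set D := _ - _.
pose rs := 0 :: [seq (x i)^-1 | i <- enum 'I_N].
apply: (@roots_geq_poly_eq0 _ D rs).
- have horner_lin a v : (1 + a *: 'X : {poly K}).[v] = 1 + a * v.
    by rewrite hornerD hornerZ hornerX hornerC.
  have DE v : D.[v] = \prod_i (1 + x i * v) - (\prod_i (1 - x i * v)
     + \sum_i (2 * qres i * x i) * (v * \prod_(j < N | j != i) (1 - x j * v))).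
    rewrite /D hornerD hornerN hornerD !horner_prod horner_sum.
    congr (_ - (_ + _)).
    - by apply: eq_bigr => i _; rewrite horner_lin.
    - by apply: eq_bigr => i _; rewrite linN horner_lin mulNr.
    - apply: eq_bigr => i _; rewrite hornerZ hornerM hornerX horner_prod.
      by congr (_ * (_ * _)); apply: eq_bigr => j _; rewrite linN horner_lin mulNr.
  rewrite /= /root DE; apply/andP; split.
    rewrite !big1 ?addr0 ?subrr // => i _;
      by rewrite !(mul0r, mulr0, subr0, addr0).
  apply/allP => _ /mapP[k _ ->]; rewrite /root DE.
  rewrite [X in _ - (X + _)](bigD1 k) //= mulfV // subrr mul0r add0r.
  rewrite [X in _ - X](bigD1 k) //= [X in _ - (_ + X)]big1 ?addr0; last first.
    move=> i ik; rewrite (bigD1 k) 1?eq_sym //= mulfV // subrr mul0r.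
    by rewrite !mulr0.
  rewrite (bigD1 k) //= mulfV // -mulr2n.
  (* At 1/x_k only the k-th summand survives; its residue turns the factors 1 - x_j/x_k into 1 +
     x_j/x_k, and the 2 matches the factor j = k on the left. *)
  have -> : 2 * qres k * x k * ((x k)^-1 * \prod_(j < N | j != k) (1 - x j / x k)) =
     2 * \prod_(j < N | j != k) (1 + x j / x k).
    rewrite mulrA mulfK // -mulrA; congr (_ * _); rewrite -big_split /=.
    apply: eq_bigr => j jk; have nz : x k - x j != 0.
      by rewrite subr_eq0 (inj_eq x_inj) eq_sym.
    by field; rewrite nz x_neq0.
  by rewrite subrr.
- rewrite /= map_inj_uniq ?enum_uniq ?andbT; last by move=> i j /invr_inj/x_inj.
  by apply/mapP => -[i _ /eqP]; rewrite eq_sym invr_eq0 (negbTE (x_neq0 i)).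
- rewrite /= size_map size_enum_ord /D.
  rewrite (leq_trans (size_polyD _ _)) // geq_max size_polyN.
  rewrite (leq_trans (size_prod _ _)) /= ?cardT ?size_enum_ord //.
  rewrite (leq_trans (size_polyD _ _)) // geq_max.
  rewrite (eq_bigr _ (fun i _ => linN i)) (leq_trans (size_prod _ _)) /= ?cardT ?size_enum_ord //.
  apply: leq_trans (size_sum _ _ _) _; apply/bigmax_leqP => i _.
  apply: leq_trans (size_scale_leq _ _) _; apply: leq_trans (size_polyMleq _ _) _.
  rewrite size_polyX add2n /= ltnS (eq_bigr _ (fun j _ => linN j)).
  apply: leq_trans (size_prod _ _) _.
  by rewrite (cardC1 i) card_ord prednK //; apply: leq_ltn_trans (ltn_ord i).
Qed.

Lemma horner_algE (A : comAlgType K) (v : A) (a : K) :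
  horner_alg v (1 + a *: 'X) = 1 + a *: v.
Proof.
by rewrite -mul_polyC rmorphD rmorphM rmorph1 /= horner_algC horner_algX mulr_algl.
Qed.

(** Homogenised so that one identity serves for B(w), with u = 1 and v = t, and for B(w+1), with u =
    1 + t and v = t/(1+t). *)
Lemma qres_homogeneous (A : comAlgType K) (u v w : A) : w = u * v ->
  \prod_i (u + x i *: w) =
  \prod_i (u - x i *: w) +
    \sum_i (2 * qres i * x i) *: (w * \prod_(j < N | j != i) (u - x j *: w)).
Proof.
move=> ->; have fac a : u + a *: (u * v) = u * (1 + a *: v).
  by rewrite mulrDr mulr1 scalerAr.
have facN a : u - a *: (u * v) = u * (1 - a *: v).
  by rewrite -scaleNr fac scaleNr.
under eq_bigr => i _ do rewrite fac.
under [X in _ = X + _]eq_bigr => i _ do rewrite facN.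
have facS i : u * v * \prod_(j < N | j != i) (u - x j *: (u * v)) =
   (\prod_(j < N) u) * (v * \prod_(j < N | j != i) (1 - x j *: v)).
  rewrite (eq_bigr _ (fun j _ => facN (x j))) big_split /= [X in _ = X * _](bigD1 i) //=.
  by rewrite mulrA -!mulrA; congr (_ * _); rewrite mulrCA.
under [X in _ = _ + X]eq_bigr => i _ do rewrite facS scalerAr.
rewrite -mulr_sumr !big_split /= -mulrDr; congr (_ * _).
have algXE c p : horner_alg v (c *: ('X * p)) = c *: (v * horner_alg v p).
  by rewrite -mul_polyC !rmorphM /= horner_algC horner_algX mulr_algl.
have := congr1 (horner_alg v) qres_partial_fractions.
rewrite rmorphD !rmorph_prod raddf_sum.
under eq_bigr => i _ do rewrite /= horner_algE.
under [X in _ = X + _ -> _]eq_bigr => i _ do rewrite /= -scaleNr horner_algE scaleNr.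
move=> ->; congr (_ + _); apply: eq_bigr => i _.
rewrite [LHS]algXE rmorph_prod; congr (_ *: (_ * _)).
by apply: eq_bigr => j _; rewrite /= -scaleNr horner_algE scaleNr.
Qed.

Section Series.
Variables (A : comAlgType K) (t : A) (M : nat).
Hypothesis tM : t ^+ M.+1 = 0.
Local Notation tser := (tser t M).
Local Notation geo := (geo t M).
Local Notation tau := (tau t M).

(** Over the fraction field [qcoef], [ecoef] and [pcoef] will be the images of beta_k, of the
    left-hand side at n, and of c_(2s+1). *)
Definition qcoef k : K := if k is 0 then 1 else 2 * \sum_i qres i * x i ^+ k.
Definition ecoef n : K :=
  if n is n'.+1 then 2 * \sum_i qres i * (x i * (x i ^+ n' - (x i - 1) ^+ n')) else 0.
Definition pcoef s : K := (\sum_i ccoef x s i * x i) *+ 2.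

(* With t = 1/w, qser_at x is B(w) and qser_at (x - 1) is B(w + 1). *)
Definition qser_at (y : 'I_N -> K) : A := 1 + \sum_i (2 * qres i * x i) *: (t * geo (y i)).

Lemma tser_qcoef : tser qcoef = qser_at x.
Proof.
rewrite /qser_at -(tser1 t M); under eq_bigr => i _ do rewrite tser_shift // -tserZ.
rewrite -tser_sum -tserD; apply: eq_tser => -[|k] /=.
  by rewrite big1 ?addr0 // => i _; rewrite mulr0.
rewrite add0r mulr_sumr; apply: eq_bigr => i _; rewrite exprS; ring.
Qed.

Lemma tser_ecoef : tser ecoef = qser_at x - qser_at (fun i => x i - 1).
Proof.
rewrite /qser_at opprD addrACA subrr add0r -sumrB.
under eq_bigr => i _ do rewrite !tser_shift // -!tserZ -tserB.
rewrite -tser_sum; apply: eq_tser => -[|k] /=.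
  by rewrite big1 // => i _; rewrite !mulr0 subr0.
rewrite mulr_sumr; apply: eq_bigr => i _; ring.
Qed.

Lemma qser_at_prod (u v : A) (y : 'I_N -> K) :
  t = u * v -> (forall i, 1 - y i *: t = u - x i *: t) ->
  qser_at y * \prod_i (u - x i *: t) = \prod_i (u + x i *: t).
Proof.
move=> tuv yx; rewrite (qres_homogeneous tuv) /qser_at mulrDl mul1r; congr (_ + _).
rewrite mulr_suml; apply: eq_bigr => i _; rewrite -scalerAl; congr (_ *: _).
rewrite (bigD1 i) //= -mulrA; congr (_ * _).
by rewrite mulrA -yx [geo _ * _]mulrC geoP // mul1r.
Qed.

(* 1 - csum k is the product over m >= k of (T - x_m(x_m+1))/(T - x_m(x_m-1)),
   where tau = 1/T. *)
Definition csum (k : nat) : A :=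
  \sum_(m < N | (k <= m)%N) (2 * x m) *: \sum_(s < M.+1) ccoef x s m *: tau ^+ s.+1.

(** Summed against powers of tau, the recursion of [ccoef] reads (1 - (x_i^2 - x_i) tau) E_i = tau
    (1 - csum (i+1)). Passing from i + 1 to i subtracts 2 x_i E_i. *)
Lemma csum_rec (i : 'I_N) :
  (1 - csum i) * (1 - (x i ^+ 2 - x i) *: tau) = (1 - csum i.+1) * (1 - (x i ^+ 2 + x i) *: tau).
Proof.
set E := fun m : 'I_N => \sum_(s < M.+1) ccoef x s m *: tau ^+ s.+1.
have cE : csum i = (2 * x i) *: E i + csum i.+1.
  rewrite /csum (bigD1 i) //=; congr (_ + _); apply: eq_bigl => m.
  by rewrite ltn_neqAle eq_sym andbC.
have EE : E i = tau * (1 + (x i ^+ 2 - x i) *: E i - csum i.+1).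
  rewrite {1}/E big_ord_recl expr1 scale1r /= mulrBr mulrDr mulr1 -addrA; congr (_ + _).
  have -> : tau * ((x i ^+ 2 - x i) *: E i) - tau * csum i.+1 =
      \sum_(s < M.+1) ccoef x s.+1 i *: tau ^+ s.+2.
    rewrite -scalerAr /E mulr_sumr scaler_sumr /csum mulr_sumr.
    under [X in _ - X]eq_bigr => m _ do rewrite -scalerAr mulr_sumr scaler_sumr.
    rewrite exchange_big -sumrB; apply: eq_bigr => s _ /=.
    rewrite [in RHS]scalerBl -scalerAr -exprS scalerA mulrC; congr (_ - _).
    rewrite -sumrMnl scaler_suml; apply: eq_bigr => m _.
    rewrite -scalerAr -exprS scalerA; congr (_ *: _); ring.
  (* The shifted sum has one extra term, in tau^(M+2), which is 0. *)
  by rewrite big_ord_recr /= (tau_nilpotent tM) // scaler0 addr0.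
have {}EE : (1 - (x i ^+ 2 - x i) *: tau) * E i = tau * (1 - csum i.+1).
  rewrite mulrBl mul1r {1}EE -scalerAl scalerAr -mulrBr addrAC addrK.
  by [].
have -> : 1 - (x i ^+ 2 + x i) *: tau = 1 - (x i ^+ 2 - x i) *: tau - (2 * x i) *: tau.
  by rewrite -addrA -opprD -scalerDl; congr (_ - _ *: _); ring.
have -> : 1 - csum i = (1 - csum i.+1) - (2 * x i) *: E i.
  by rewrite cE [X in 1 - X]addrC opprD addrA.
rewrite [LHS]mulrBl [RHS]mulrBr -scalerAl [E i * _]mulrC EE -!scalerAr.
by rewrite [tau * _]mulrC.
Qed.

Lemma csum_prod :
  (1 - csum 0) * \prod_i (1 - (x i ^+ 2 - x i) *: tau) = \prod_i (1 - (x i ^+ 2 + x i) *: tau).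
Proof.
have step k : (k <= N)%N ->
  (1 - csum (N - k)) * \prod_(i < N | (N - k <= i)%N) (1 - (x i ^+ 2 - x i) *: tau) =
  \prod_(i < N | (N - k <= i)%N) (1 - (x i ^+ 2 + x i) *: tau).
  elim: k => [_|k IH kN].
    rewrite /csum subn0 !big_pred0 ?subr0 ?mulr1 // => i;
      by apply/negbTE; rewrite -ltnNge.
  have lt : (N - k.+1 < N)%N by lia.
  pose i := Ordinal lt; have iE : (i : nat) = (N - k.+1)%N by [].
  have split (m : 'I_N) : ((N - k.+1 <= m) && (m != i))%N = (N - k <= m)%N.
    by rewrite -val_eqE /=; lia.
  rewrite [in LHS](bigD1 i) 1?[in RHS](bigD1 i) /= ?leqnn // -[X in csum X]iE mulrA csum_rec mulrAC.
  rewrite (eq_bigl _ _ split) [in RHS](eq_bigl _ _ split) mulrC -IH; last by lia.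
  by rewrite iE (_ : (N - k.+1).+1 = (N - k)%N) //; lia.
by have := step N (leqnn N); rewrite subnn.
Qed.

Lemma csum0 : csum 0 = \sum_(s < M.+1) pcoef s *: tau ^+ s.+1.
Proof.
rewrite /csum; under eq_bigr => m _ do rewrite scaler_sumr.
rewrite exchange_big; apply: eq_bigr => s _ /=.
rewrite /pcoef -sumrMnl scaler_suml; apply: eq_bigr => m _.
by rewrite scalerA; congr (_ *: _); ring.
Qed.

Lemma ecoef_series : tser ecoef = tser qcoef * \sum_(s < M.+1) pcoef s *: tau ^+ s.+1.
Proof.
rewrite -csum0 tser_ecoef tser_qcoef; set B := qser_at x; set B' := qser_at _.
have tN1 := geoN1 tM.
have hB : B * \prod_i (1 - x i *: t) = \prod_i (1 + x i *: t).
  by apply: (@qser_at_prod 1 t x); rewrite ?mul1r.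
have hB' : B' * \prod_i (1 + t - x i *: t) = \prod_i (1 + t + x i *: t).
  apply: (@qser_at_prod (1 + t) (t * geo (-1))).
    by rewrite mulrCA tN1 mulr1.
  by move=> i; rewrite scalerBl scale1r opprB addrA.
have facm i : (1 + t) * (1 - (x i ^+ 2 - x i) *: tau) = (1 + x i *: t) * (1 + t - x i *: t).
  have -> : (1 + t) * (1 - (x i ^+ 2 - x i) *: tau) =
      1 + t - ((x i *: t) ^+ 2 - t * (x i *: t)).
    by rewrite mulrBr mulr1 -scalerAr (tauP tM) exprZn -scalerAr -expr2 -scalerBl.
  by ring.
have facp i : (1 + t) * (1 - (x i ^+ 2 + x i) *: tau) = (1 - x i *: t) * (1 + t + x i *: t).
  have -> : (1 + t) * (1 - (x i ^+ 2 + x i) *: tau) =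
      1 + t - ((x i *: t) ^+ 2 + t * (x i *: t)).
    by rewrite mulrBr mulr1 -scalerAr (tauP tM) exprZn -scalerAr -expr2 -scalerDl.
  by ring.
have cancel (f : 'I_N -> A) (g : 'I_N -> A) a b : (forall i, f i * g i = 1) ->
   a * \prod_i f i = b * \prod_i f i -> a = b.
  move=> fg e; have fg1 : (\prod_i f i) * (\prod_i g i) = 1.
    by rewrite -big_split big1 //= => i _; exact: fg.
  by rewrite -[a]mulr1 -fg1 mulrA e -mulrA fg1 mulr1.
have unit1 y : (1 - y *: t) * geo y = 1 by exact: geoP.
have hP : (1 - csum 0) * (\prod_i (1 + x i *: t) * \prod_i (1 + t - x i *: t)) =
   \prod_i (1 - x i *: t) * \prod_i (1 + t + x i *: t).
  rewrite -!big_split /= -(eq_bigr _ (fun i _ => facm i)) -(eq_bigr _ (fun i _ => facp i)).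
  by rewrite !big_split /= -csum_prod mulrCA.
(* Both denominators are products of units, inverted by [geo], and can be cancelled after
   multiplying out. *)
have : B * (1 - csum 0) = B'.
  apply: (cancel (fun i => 1 - (x i - 1) *: t) (fun i => geo (x i - 1))) => //.
  under eq_bigr => i _ do rewrite scalerBl scale1r opprB addrA.
  rewrite hB'.
  apply: (cancel (fun i => 1 - x i *: t) (fun i => geo (x i))) => //.
  by rewrite [RHS]mulrC -hP -hB; ring.
by move=> e; rewrite -e mulrBr mulr1 opprB addrC subrK.
Qed.

End Series.
End PartialFractions.

(** * Comparison of coefficients in K[X]/(X^(M+1)) *)

Section SeriesModel.
Variables (K : fieldType) (M : nat).
Local Notation h := ('X^(M.+1) : {poly K}).
Definition sX : {poly %/ h} := in_qpoly h 'X.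

Lemma sX_nilpotent : sX ^+ M.+1 = 0.
Proof.
rewrite /sX -rmorphXn /=; apply/val_inj.
by rewrite /= mk_monic_Xn //= Pdiv.RingMonic.rmodpp ?monicXn.
Qed.

Lemma tser_inj (f g : nat -> K) k : (k <= M)%N ->
  tser sX M f = tser sX M g -> f k = g k.
Proof.
move=> kM; have tE (e : nat -> K) : tser sX M e = in_qpoly h (\poly_(i < M.+1) e i).
  rewrite poly_def raddf_sum; apply: eq_bigr => i _.
  by rewrite /= in_qpolyZ /sX rmorphXn.
rewrite !tE => /(congr1 (fun p : {poly %/ h} => (p : {poly K})`_k)).
by rewrite !in_qpoly_small ?coef_poly ?ltnS ?kM //
   mk_monic_Xn size_polyXn ltnS size_poly.
Qed.

End SeriesModel.

Lemma ecoef_eq (K : fieldType) (N : nat) (x : 'I_N -> K) n :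
  injective x -> (forall i, x i != 0) ->
  ecoef x n = \sum_(1 <= r < n./2.+1) \sum_(2 * r <= m < n.+1)
    ((-1) ^+ m * 'C(m - r - 1, r - 1)%:R) * (qcoef x (n - m) * pcoef x (r - 1)).
Proof.
move=> x_inj x_neq0; have tn := sX_nilpotent K n.
have := ecoef_series x_inj x_neq0 tn.
under [X in _ = _ * X]eq_bigr => s _ do rewrite (tau_pow tn) -tserZ.
rewrite -tser_sum (tserM tn) => /(tser_inj (leqnn n)) ->.
under eq_bigr => m _ do rewrite -ltnS ltn_ord mulr_suml.
rewrite exchange_big /= big_add1 /= big_mkord.
rewrite (big_ord_widen n.+1 (fun r => \sum_(2 * r.+1 <= m < n.+1)
   ((-1) ^+ m * 'C(m - r.+1 - 1, r.+1 - 1)%:R) * (qcoef x (n - m) * pcoef x (r.+1 - 1)))); last by lia.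
rewrite [RHS]big_mkcond; apply: eq_bigr => s _.
rewrite big_geq_mkord.
have e (i : 'I_n.+1) : (2 * s.+1 <= i)%N = (s.+1.*2 <= i)%N by rewrite mul2n.
(* The series has a term for every s up to n; those with 2(s+1) > n contribute nothing. *)
case: ltnP => sn; last first.
  apply: big1 => i _; rewrite ifF ?mulr0 ?mul0r //; apply/negbTE.
  by have := ltn_ord i; lia.
rewrite [RHS]big_mkcond; apply: eq_bigr => i _ /=; rewrite e !subSS !subn0.
by case: ifP => _; [ring | rewrite mulr0 mul0r].
Qed.

Lemma scale_sign_natr (K : comNzRingType) (A : algType K) m c (u : A) :
  ((-1) ^+ m * c%:R : K) *: u = ((-1) ^+ m * c%:R) * u.
Proof.
rewrite -scalerA scaler_nat -signr_odd scaler_sign -[in RHS]signr_odd.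
by rewrite -mulrA mulr_sign mulr_natl.
Qed.

Lemma stirling2S0 n : stirling2 n.+1 0 = 0%N.
Proof.
apply/eqP; rewrite cards_eq0; apply/eqP/setP => P; rewrite !inE.
apply/negbTE; rewrite negb_and; case: eqP => [P0|_]; last by rewrite orbT.
rewrite orbF; apply/negP => /cover_partition.
move/eqP: P0; rewrite cards_eq0 => /eqP->; rewrite /cover big_set0 => /setP/(_ ord0).
by rewrite !inE.
Qed.

(** * The identity of polynomials, in the fraction field *)

Section RowQ.
Variables (R : realType) (N : nat) (q : nat -> {mpoly R[i][N]}).
Hypothesis qP : forall k, is_rowQ k (q k).
Local Notation C := R[i].
Local Notation Kf := {fraction {mpoly C[N]}}.
Local Notation "x %:F" := (tofrac x).

Definition genx (i : 'I_N) : Kf := ('X_i : {mpoly C[N]})%:F.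

Lemma genx_inj : injective genx.
Proof.
move=> i j /eqP; rewrite /genx tofrac_eq => /eqP.
move=> /(congr1 (meval (fun k => (k == i)%:R))); rewrite !mevalXU eqxx.
by case: eqVneq => [->|_] // /eqP; rewrite oner_eq0.
Qed.

Lemma genx_neq0 i : genx i != 0.
Proof.
rewrite tofrac_eq0; apply/eqP => /(congr1 (meval (fun=> 1))).
by rewrite mevalXU meval0 => /eqP; rewrite oner_eq0.
Qed.

Lemma rowQ_frac k : (0 < k)%N ->
  (q k)%:F = 2 * \sum_i qres genx i * falling (genx i) k.
Proof.
case: k => // k _; have := qP k.+1; rewrite /is_rowQ => ->; congr (_ * _).
apply: eq_bigr => i _; rewrite mulrC falling_morph; congr (_ * _).
by apply: eq_bigr => j _; rewrite rmorphD rmorphB.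
Qed.

Lemma fracMn (p : {mpoly C[N]}) c : (p *+ c)%:F = p%:F *+ c :> Kf.
Proof. exact: tofracMn. Qed.

Lemma frac_sum I r (P : pred I) (f : I -> {mpoly C[N]}) :
  (\sum_(x <- r | P x) f x)%:F = \sum_(x <- r | P x) (f x)%:F :> Kf.
Proof. exact: raddf_sum. Qed.

(** The Stirling sum turns the falling factorials of each x_i into the power x_i^j; the missing term
    k = 0 has S(j,0) = 0 for j > 0. *)
Lemma beta_frac j : (beta q j)%:F = qcoef genx j.
Proof.
case: j => [|j]; first by rewrite /= rmorph1.
rewrite /beta frac_sum big_add1 /= big_mkord /qcoef.
under [LHS]eq_bigr => k _ do rewrite fracMn rowQ_frac // -mulrnAr -sumrMnl.
rewrite -mulr_sumr exchange_big; congr (_ * _); apply: eq_bigr => i _ /=.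
rewrite (expr_stirling2 (genx i)) [in RHS]big_ord_recl stirling2S0 mulr0n add0r mulr_sumr.
by apply: eq_bigr => k _; rewrite mulrnAr.
Qed.

Lemma lhs_frac n : (0 < n)%N ->
  (\sum_(1 <= j < n) q j *+ (j * stirling2 n.-1 j)%N)%:F = ecoef genx n.
Proof.
case: n => // n _; rewrite frac_sum big_add1 /= big_mkord.
under [LHS]eq_bigr => k _ do rewrite fracMn rowQ_frac // -mulrnAr -sumrMnl.
rewrite -mulr_sumr exchange_big; congr (_ * _); apply: eq_bigr => i _ /=.
rewrite -weighted_stirling2 [in RHS]big_ord_recl mul0n mulr0n add0r mulr_sumr.
by apply: eq_bigr => k _; rewrite mulrnAr.
Qed.

Lemma ccoef_frac s i : (ccoef (fun i => 'X_i : {mpoly C[N]}) s i)%:F = ccoef genx s i.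
Proof.
elim: s i => [|s IH] i; first exact: rmorph1.
rewrite /= tofracB tofracM tofracB tofracXn fracMn IH frac_sum.
by congr (_ - _ *+ 2); apply: eq_bigr => m _; rewrite tofracM IH.
Qed.

Definition cyclicQ s : {mpoly C[N]} :=
  (\sum_i ccoef (fun i => 'X_i : {mpoly C[N]}) s i * 'X_i) *+ 2.

Lemma cyclicQ_frac s : (cyclicQ s)%:F = pcoef genx s.
Proof.
rewrite /cyclicQ fracMn frac_sum; congr (_ *+ 2).
by apply: eq_bigr => i _; rewrite tofracM ccoef_frac.
Qed.

Lemma rowQ_identity n : (0 < n)%N ->
  \sum_(1 <= j < n) q j *+ (j * stirling2 n.-1 j)%N =
  \sum_(1 <= r < n./2.+1) \sum_(2 * r <= m < n.+1)
    ((-1) ^+ m * 'C(m - r - 1, r - 1)%:R) * (beta q (n - m)%N * cyclicQ (r - 1)).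
Proof.
move=> n0; apply/eqP; rewrite -tofrac_eq lhs_frac // (ecoef_eq _ genx_inj genx_neq0).
rewrite frac_sum; apply/eqP; apply: eq_bigr => r _.
rewrite frac_sum; apply: eq_bigr => m _ /=.
by rewrite !tofracM tofracXn tofracN tofrac1 -[_%:R%:F]/(tofrac _) rmorph_nat beta_frac cyclicQ_frac.
Qed.

End RowQ.

Theorem proposition4p1 (R : realType) (N : nat) (N_ge1 : (1 <= N)%N)
    (D : nat -> Uq R N) (D_capelli : forall k, is_capelli k (D k)) :
  let lhs n := \sum_(1 <= j < n) D j *+ (j * stirling2 n.-1 j)%N in
  let rhs n :=
    \sum_(1 <= r < n./2.+1) \sum_(2 * r <= m < n.+1)
      ((-1) ^+ m * 'C(m - r - 1, r - 1)%:R)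
        * (beta D (n - m)%N * cyclic_elt R N (2 * r - 1)%N) in
  (forall n, (1 <= n)%N -> lhs n = rhs n) /\ (lhs 1%N = 0 /\ rhs 1%N = 0).
Proof.
move=> lhs rhs; split; last by rewrite /lhs /rhs !big_geq.
move=> n n_ge1.
have Dq k : exists q, is_rowQ k q /\ HC (D k) q.
  have := D_capelli k; case: k => [|k]; last by move=> [q hq hD]; exists q.
  by rewrite /is_capelli => ->; exists 1; split; [| exact: HC1].
have [q qP] := choice Dq.
have HCMn z p c : HC z p -> HC (z *+ c : Uq R N) (p *+ c).
  by rewrite -(scaler_nat c z) -(scaler_nat c p); exact: HCZ.
have HCbeta j : HC (beta D j) (beta q j).
  case: j => [|j]; first exact: HC1.
  by apply: HC_sum => k _; apply: HCMn; have [] := qP k.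
have HClhs : HC (lhs n) (\sum_(1 <= j < n) q j *+ (j * stirling2 n.-1 j)%N).
  by apply: HC_sum => k _; apply: HCMn; have [] := qP k.
have HCrhs : HC (rhs n) (\sum_(1 <= r < n./2.+1) \sum_(2 * r <= m < n.+1)
    ((-1) ^+ m * 'C(m - r - 1, r - 1)%:R) * (beta q (n - m)%N * cyclicQ R N (r - 1))).
  rewrite /rhs !big_add1 /=; apply: HC_sum => r _; apply: HC_sum => m _.
  rewrite -!scale_sign_natr; apply/HCZ/HCM; first exact: HCbeta.
  have -> : (2 * r.+1 - 1 = r.*2.+1)%N by lia.
  by rewrite subSS subn0; exact: HC_cyclic.
(* The difference of the two sides is central and, by [rowQ_identity], has image 0. *)
have [cz] := HCD HClhs (HCZ (-1) HCrhs).
have qQ k : is_rowQ k (q k) by have [] := qP k.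
rewrite (rowQ_identity qQ n_ge1) !scaleN1r subrr => hz.
have ev0 : eval_cartan (0 : {mpoly R[i][N]}) = 0 :> Uq R N by exact: mmap0.
rewrite ev0 subr0 in hz; rewrite scaleN1r in cz.
by apply/eqP; rewrite -subr_eq0; apply/eqP; exact: HC_injective.
Qed.
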